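(* Let $G$ be a graph, let $z\in V(G)$, and let $k$ be a positive integer. If $G$ is $(3k-3)$-edge-connected or $(2k-2)$-tree-connected, then $G$ can be edge-decomposed into $k$ factors $G_1,\ldots,G_k$ satisfying $\big||E(G_i)|-|E(G)|/k\big|<1$ for all $i$, such that for each $i$ and each vertex $v$, $$|d_{G_i}(v)-d_G(v)/k|<\begin{cases}2 & \text{if } v=z,\\ 1 & \text{otherwise.}\end{cases}$$ Furthermore, the decomposition can be chosen so that in addition $|d_{G_i}(z)-d_{G_j}(z)|\le 2$ for all $1\le i,j\le k$.
   Context: Graphs are finite and may have loops and multiple edges; a loop contributes $2$ to the degree $d_G(v)$. A factor is a spanning subgraph; ''edge-decomposed into factors $G_1,\ldots,G_k$'' means $E(G)$ is partitioned into $E(G_1),\ldots,E(G_k)$ with each $G_i$ spanning. A graph is $m$-tree-connected if it contains $m$ edge-disjoint spanning trees. *)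

(* Defs.v *)
From mathcomp Require Import all_boot.

Set Implicit Arguments.
Unset Strict Implicit.
Unset Printing Implicit Defensive.

(* Finite multigraph. The pair [ends e] is ordered only for convenience: every
   notion below is symmetric in its two components. A loop has equal ends, and
   parallel edges have the same ends up to order. *)
Record mgraph := MGraph {
  vertex : finType;
  edge : finType;
  ends : edge -> vertex * vertex
}.

Section Multigraph.
Variable G : mgraph.
Implicit Types (F : {set edge G}) (e : edge G) (x y v : vertex G).

Definition joins e x y : bool := (ends e == (x, y)) || (ends e == (y, x)).

(* A factor (spanning subgraph) of G is represented by its edge set F; G itself
   is [set: edge G]. *)

(* A loop at v satisfies both tests, hence contributes 2. *)
Definition deg F v : nat :=
  \sum_(e in F) (((ends e).1 == v) + ((ends e).2 == v)).

Definition adj F : rel (vertex G) := fun x y => [exists e in F, joins e x y].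

Definition connected F : bool := [forall x, forall y, connect (adj F) x y].

(* The sequence (x_0, e_0), ..., (x_n, e_n) is a cycle when e_i joins x_i to
   x_(i+1), indices being cyclic, with distinct vertices and distinct edges;
   n = 0 is a loop and n = 1 a pair of parallel edges. *)
Definition is_cycle F (s : seq (vertex G * edge G)) : bool :=
  [&& s != [::], all (fun p => p.2 \in F) s,
      uniq [seq p.1 | p <- s], uniq [seq p.2 | p <- s]
    & cycle (fun p q => joins p.2 p.1 q.1) s].

Definition acyclic F : Prop := forall s, ~~ is_cycle F s.

Definition spanning_tree F : Prop := connected F /\ acyclic F.

Definition tree_connected (m : nat) : Prop :=
  exists T : 'I_m -> {set edge G},
    (forall i, spanning_tree (T i)) /\
    (forall i j, i != j -> [disjoint T i & T j]).

(* Deleting fewer than m edges never disconnects the graph. Every graph is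
   0-edge-connected, and a one-vertex graph is m-edge-connected for all m. *)
Definition edge_connected (m : nat) : Prop :=
  forall D : {set edge G}, #|D| < m -> connected (~: D).

(* Factors may have no edges, unlike the blocks of [finset.partition]. *)
Definition edge_decomposition (k : nat) (F : 'I_k -> {set edge G}) : Prop :=
  \bigcup_i F i = [set: edge G] /\
  (forall i j, i != j -> [disjoint F i & F j]).

End Multigraph.

Arguments tree_connected : clear implicits.
Arguments edge_connected : clear implicits.

(* Main.v *)
Require Import Defs.
From mathcomp Require Import all_boot all_order all_algebra.
From mathcomp Require Import zify.

Set Implicit Arguments.
Unset Strict Implicit.
Unset Printing Implicit Defensive.

Import Order.TTheory GRing.Theory Num.Theory.
Local Open Scope ring_scope.

(** If [G] has an orientation in which every vertex other than [z] has out-degree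
    divisible by [k], view [G] as a bipartite graph between tails and heads and
    colour its edges with [k] colours, each as equitably as possible at every tail
    and at every head. The colour classes share the out-degree of [v <> z] exactly
    and its in-degree up to rounding, and only at [z] is there a second rounding.

    The orientation is found as in Lovász, Thomassen, Wu and Zhang. With [K = 2k],
    prescribe the net out-degree [c v] modulo [K] at each vertex; it exists as soon
    as every cut [A] has at least [K - 2 + dist (c A)] edges, [dist] being the
    distance to the multiples of [K]. For the induction some vertices are joined
    to a root by edges that are already oriented. A tight cut splits the problem
    into a contraction and an inner part rooted at the contracted complement;
    without tight cuts one can delete an oriented edge or split off a pair of edges.

    For [2k - 2] disjoint spanning subgraphs, a vertex of degree at most [3k - 3]
    is removed by splitting off its surplus edges, so that single vertices satisfy
    the cut condition; then a smallest set [A] violating it is contracted, and the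
    first result applies inside [A]. *)

(** * Distance to the multiples of 2k *)

Section DistanceToMultiples.
Variable k : nat.
Hypothesis k_gt0 : (0 < k)%N.
Notation K := (2 * k)%:Z.

Definition dist_mul (n : int) : int := Num.min (n %% K)%Z (K - (n %% K)%Z).

(** The remainder is moved to the symmetric range from [-k] to [k], where the distance is an
    absolute value; the later facts about [dist_mul] rest on this form. *)
Lemma dist_mulE (n : int) :
  exists a q, [/\ n = a + K * q, `|a| <= k & dist_mul n = `|a|].
Proof.
have en := divz_eq n K; have K_neq0 : K != 0 by lia.
have ge_r := modz_ge0 n K_neq0; have lt_r : (n %% K)%Z < K by apply: ltz_pmod; lia.
rewrite /dist_mul; move: (n %% K)%Z (n %/ K)%Z en ge_r lt_r => r q en ge_r lt_r.
have [le_r|gt_r] := lerP r (K - r).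
  by exists r, q; split; lia.
by exists (r - K), (q + 1); split; lia.
Qed.

Lemma dist_mul_small (a q : int) : `|a| <= k -> dist_mul (a + K * q) = `|a|.
Proof.
move=> le_a; have [a' [q' [e le_a' ->]]] := dist_mulE (a + K * q).
have {}e : a - a' = K * (q' - q) by lia.
have : `|K * (q' - q)| <= K by lia.
rewrite normrM => le_K.
have : `|q' - q| <= 1.
  have: `|q' - q| < 2 by rewrite -(@ltr_pM2l _ `|K|); lia.
  by lia.
(* If the quotients differ, they do so by one, and the two representatives are [k] and [-k], with
   the same absolute value. *)
move=> le1; have [d0|[d1|d1]] : q' - q = 0 \/ q' - q = 1 \/ q' - q = -1 by lia.
all: rewrite ?d0 ?d1 in e; lia.
Qed.

Lemma dist_mulDK (n q : int) : dist_mul (n + K * q) = dist_mul n.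
Proof.
have [a [q' [-> le_a ->]]] := dist_mulE n.
by rewrite -addrA -mulrDr dist_mul_small.
Qed.

Lemma dist_mul_mod (m n : int) : (K %| m - n)%Z -> dist_mul m = dist_mul n.
Proof.
by case/dvdzP => q e; rewrite -(dist_mulDK n q); congr dist_mul; lia.
Qed.

Lemma dist_mul_ge0 n : 0 <= dist_mul n.
Proof. by have [a [q [_ _ ->]]] := dist_mulE n. Qed.

Lemma dist_mul_le n : dist_mul n <= k.
Proof. by have [a [q [_ ? ->]]] := dist_mulE n. Qed.

Lemma dist_mul_le_norm n : dist_mul n <= `|n|.
Proof.
have [le_n|gt_n] := lerP `|n| k%:Z.
  by rewrite -[n in dist_mul n]addr0 -(mulr0 K) dist_mul_small.
by have := dist_mul_le n; lia.
Qed.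

Lemma dist_mulN n : dist_mul (- n) = dist_mul n.
Proof.
have [a [q [-> le_a ->]]] := dist_mulE n.
by rewrite opprD -mulrN dist_mul_small ?normrN.
Qed.

Lemma dist_mulD m n : dist_mul (m + n) <= dist_mul m + `|n|.
Proof.
have [a [q [-> le_a ->]]] := dist_mulE m.
rewrite addrAC dist_mulDK; apply: le_trans (dist_mul_le_norm _) _.
exact: ler_normD.
Qed.

(** Here [p] and [q] will say whether a set contains the ends of a deleted edge: only an edge
    crossing the set changes its target. *)
Lemma dist_mul_shift n (p q : bool) :
  dist_mul (n - p%:Z + q%:Z) <= dist_mul n + `|p%:Z - q%:Z|.
Proof.
have [->|pq] := eqVneq p q; first by rewrite subrK subrr addr0.
by rewrite -addrA distrC (addrC (- _)); apply: dist_mulD.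
Qed.

Lemma dist_mul_triangle m n : dist_mul (m + n) <= dist_mul m + dist_mul n.
Proof.
have [a [q [-> le_a ->]]] := dist_mulE n.
by rewrite addrA dist_mulDK dist_mulD.
Qed.

Lemma dist_mul_parity n : (2 %| dist_mul n - n)%Z.
Proof.
have [a [q [-> le_a ->]]] := dist_mulE n; lia.
Qed.

Lemma dist_mul_eq0 n : (dist_mul n == 0) = (K %| n)%Z.
Proof.
have [a [q [-> le_a ->]]] := dist_mulE n; rewrite normr_eq0.
apply/eqP/dvdzP => [-> | [u e]]; first by exists q; lia.
have := @dist_mul_small a q le_a; have -> : a + K * q = 0 + K * u by lia.
by rewrite dist_mul_small ?normr0 //; lia.
Qed.

Lemma dist_mul_step n :
  ~~ (K %| n)%Z -> exists2 e : int, e = 1 \/ e = -1 &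
    dist_mul (n - e) = dist_mul n - 1.
Proof.
rewrite -dist_mul_eq0; have [a [q [-> le_a ->]]] := dist_mulE n => a0.
exists (if 0 < a then 1 else -1); first by case: ifP; lia.
by case: (ltP 0 a) => ha; rewrite addrAC dist_mul_small; lia.
Qed.

(** From residue [k] both steps lead closer to a multiple of [2k]; a negative residue gets closer by
    adding 1, and 0 cannot get closer. What remains lies strictly between 0 and [k]. *)
Lemma dist_mul_down n :
    dist_mul (n - 1) = dist_mul n - 1 -> dist_mul (n + 1) <> dist_mul n - 1 ->
  exists r q, [/\ n = r + K * q, 0 < r, r < k%:Z & dist_mul n = r].
Proof.
have [a [q [-> le_a ->]]] := dist_mulE n => e1 e2.
have a_gt0 : 0 < a.
  rewrite ltNge; apply/negP => a_le0.
  have [a_lt0|a_ge0] := ltrP a 0.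
    by apply: e2; rewrite addrAC dist_mul_small; lia.
  by have := dist_mul_ge0 (a + K * q - 1); rewrite e1; lia.
exists a, q; split => //; try lia.
rewrite lt_neqAle; apply/andP; split; last lia.
apply/eqP => ak; apply: e2.
have -> : a + K * q + 1 = (1 - k%:Z) + K * (q + 1) by lia.
by rewrite dist_mul_small; lia.
Qed.

End DistanceToMultiples.

(** * Cuts, net out-degrees and splitting off *)

Section Cuts.
Variables V ET : finType.
Implicit Types (g : ET -> V * V) (e f : ET) (E F : {set ET}) (A B W : {set V}).
Implicit Types (x y v w : V) (o : ET -> int) (b c s : V -> int).

Definition delta g e A : int := ((g e).1 \in A)%:Z - ((g e).2 \in A)%:Z.
Definition cut g E A : int := \sum_(e in E) `|delta g e A|.
Definition net g o E A : int := \sum_(e in E) o e * delta g e A.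
(** The sign 1 directs an edge from its first listed end to the second and -1 directs it back, so
    [net] counts edges leaving a set minus edges entering it. Loops count in neither [net] nor
    [cut]. *)
Definition signing o : Prop := forall e, o e = 1 \/ o e = -1.
Definition weight b A : int := \sum_(v in A) b v.
Definition ends_in g E W : Prop := forall e, e \in E -> (g e).1 \in W /\ (g e).2 \in W.
Definition has_ends g e x y : Prop := g e = (x, y) \/ g e = (y, x).

Lemma delta_sum g e A : delta g e A = \sum_(v in A) delta g e [set v].
Proof.
have ind x : (x \in A)%:Z = \sum_(v in A) (x \in [set v])%:Z.
  have [xA|xNA] := boolP (x \in A).
    rewrite (bigD1 x) //= set11 big1 ?addr0 // => v /andP[_ vx].
    by rewrite in_set1 eq_sym (negPf vx).
  rewrite big1 // => v vA; rewrite in_set1; case: eqP => // xv.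
  by rewrite xv vA in xNA.
by rewrite /delta !ind -sumrB.
Qed.

Lemma net_sum g o E A : net g o E A = \sum_(v in A) net g o E [set v].
Proof.
rewrite /net exchange_big /=; apply: eq_bigr => e _.
by rewrite delta_sum mulr_sumr.
Qed.

Lemma net_weight g o E A : net g o E A = weight (fun v => net g o E [set v]) A.
Proof. exact: net_sum. Qed.

Lemma dvdz_sum (I : Type) (r : seq I) (P : pred I) (F : I -> int) (d : int) :
  (forall i, P i -> d %| F i)%Z -> (d %| \sum_(i <- r | P i) F i)%Z.
Proof. exact: rpred_sum. Qed.

Lemma parity_sum_norm (I : Type) (r : seq I) (P : pred I) (F : I -> int) :
  (2 %| \sum_(i <- r | P i) `|F i| - \sum_(i <- r | P i) F i)%Z.
Proof. by rewrite -sumrB; apply: dvdz_sum => i _; lia. Qed.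

(** Modulo 2 signs do not matter, and [delta] is additive over the vertices of [A]. *)
Lemma parity_cut g E A : (2 %| cut g E A - weight (fun v => cut g E [set v]) A)%Z.
Proof.
have -> : cut g E A - weight (fun v => cut g E [set v]) A =
   \sum_(e in E) (`|delta g e A| - \sum_(v in A) `|delta g e [set v]|).
  by rewrite sumrB; congr (_ - _); rewrite /weight /cut exchange_big.
apply: dvdz_sum => e _.
have := parity_sum_norm (index_enum V) (mem A) (fun v => delta g e [set v]).
by rewrite -delta_sum /=; lia.
Qed.

Lemma weightB b c A : weight b A - weight c A = weight (fun v => b v - c v) A.
Proof. by rewrite /weight sumrB. Qed.

Lemma weightD b c A : weight b A + weight c A = weight (fun v => b v + c v) A.
Proof. by rewrite /weight big_split. Qed.

Lemma weight1 b v : weight b [set v] = b v.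
Proof. by rewrite /weight big_set1. Qed.

Lemma eq_weight b c A : {in A, b =1 c} -> weight b A = weight c A.
Proof. by move=> bc; apply: eq_bigr => v /bc. Qed.

Lemma weight_norm_le b s A : {in A, forall v, `|b v| <= s v} ->
  `|weight b A| <= weight s A.
Proof.
move=> le_bs; apply: le_trans (ler_norm_sum _ _ _) _.
by apply: ler_sum => v /le_bs.
Qed.

Lemma weight_ge0 s A : {in A, forall v, 0 <= s v} -> 0 <= weight s A.
Proof. by move=> s0; apply: sumr_ge0 => v /s0. Qed.

Lemma dvdz_weight (d : int) b A : {in A, forall v, d %| b v}%Z -> (d %| weight b A)%Z.
Proof. by move=> db; apply: dvdz_sum => v /db. Qed.

Lemma parity_cut_weight g E A c : {in A, forall v, 2 %| cut g E [set v] - c v}%Z ->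
  (2 %| cut g E A - weight c A)%Z.
Proof.
move=> par; have := parity_cut g E A; have := dvdz_weight par.
by rewrite -weightB; lia.
Qed.

Lemma weight_setD b A W : A \subset W -> weight b W = weight b A + weight b (W :\: A).
Proof.
move=> sAW; rewrite /weight (big_setID A) /=; congr (_ + _).
by rewrite (setIidPr sAW).
Qed.

Lemma weight_upd b x (d : int) A :
  weight (fun v => b v + (v == x)%:Z * d) A = weight b A + (x \in A)%:Z * d.
Proof.
rewrite -weightD; congr (_ + _); rewrite /weight.
have [xA|xNA] := boolP (x \in A).
  rewrite (bigD1 x) //= eqxx big1 ?addr0 // => v /andP[_ /negPf->].
  by rewrite mul0r.
rewrite big1 ?mul0r // => v vA; case: eqP => [vx|]; last by rewrite mul0r.
by rewrite -vx vA in xNA.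
Qed.

Lemma delta_ends g e x y A : has_ends g e x y ->
  `|delta g e A| = `|(x \in A)%:Z - (y \in A)%:Z|.
Proof. by rewrite /delta => -[->|->] //=; lia. Qed.

Lemma has_ends_sym g e x y : has_ends g e x y -> has_ends g e y x.
Proof. by case; [right | left]. Qed.

Lemma incident_ends g e x : delta g e [set x] != 0 ->
  exists2 y, has_ends g e x y & y != x.
Proof.
rewrite /delta !inE /has_ends; case: (g e) => u v /=.
have [->|ux] := eqVneq u x; have [->|vx] := eqVneq v x => //= _.
  by exists v => //; left.
by exists u => //; right.
Qed.

Lemma crossing_ends g e A : delta g e A != 0 ->
  exists x y, [/\ has_ends g e x y, x \in A & y \notin A].
Proof.
rewrite /delta /has_ends; case: (g e) => u v /=.
have [uA|uA] := boolP (u \in A); have [vA|vA] := boolP (v \in A) => //= _.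
  by exists u, v; split=> //; left.
by exists v, u; split=> //; right.
Qed.

Lemma has_ends_in g E W e x y : ends_in g E W -> e \in E -> has_ends g e x y ->
  x \in W /\ y \in W.
Proof.
by move=> gW /gW[]; rewrite /has_ends; case: (g e) => u v /= uW vW [] [<- <-].
Qed.

Lemma cut_compl g E A W : ends_in g E W -> cut g E (W :\: A) = cut g E A.
Proof.
move=> gW; apply: eq_bigr => e /gW[uW vW].
by rewrite /delta !inE uW vW !andbT; lia.
Qed.

Lemma net_compl g o E A W : ends_in g E W -> net g o E (W :\: A) = - net g o E A.
Proof.
move=> gW; rewrite /net -sumrN; apply: eq_bigr => e /gW[uW vW].
by rewrite /delta !inE uW vW !andbT; lia.
Qed.

Lemma delta0 g e : delta g e set0 = 0. Proof. by rewrite /delta !inE. Qed.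

Lemma net0 g o E : net g o E set0 = 0.
Proof. by rewrite /net big1 // => e _; rewrite delta0 mulr0. Qed.

Lemma net_full g o E W : ends_in g E W -> net g o E W = 0.
Proof. by move=> gW; rewrite -[LHS]opprK -(net_compl o W gW) setDv net0. Qed.

Lemma cut_gt0 g E A : 0 < cut g E A -> exists2 e, e \in E & delta g e A != 0.
Proof.
move=> cA; apply/exists_inP; apply: contraTT cA; rewrite negb_exists_in => /forall_inP dA.
rewrite /cut big1 ?ltxx // => e /dA.
by rewrite negbK => /eqP->; rewrite normr0.
Qed.

Lemma parity_net g o E A : signing o -> (2 %| net g o E A - cut g E A)%Z.
Proof.
by move=> so; rewrite /net /cut -sumrB; apply: dvdz_sum => e _; case: (so e) => ->; lia.
Qed.

Lemma cut_setD1 g E e A : e \in E -> cut g E A = `|delta g e A| + cut g (E :\ e) A.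
Proof. by move=> eE; rewrite /cut (big_setD1 e). Qed.

Lemma net_setD1 g o E e A : e \in E ->
  net g o E A = o e * delta g e A + net g o (E :\ e) A.
Proof. by move=> eE; rewrite /net (big_setD1 e). Qed.

Lemma eq_net_ends g g' o o' E A :
    (forall e, e \in E -> o e * delta g e A = o' e * delta g' e A) ->
  net g o E A = net g' o' E A.
Proof. by move=> oo'; apply: eq_bigr. Qed.

Lemma cut_split g E F A : F \subset E -> cut g E A = cut g F A + cut g (E :\: F) A.
Proof. by move=> sFE; rewrite /cut (big_setID F) /= (setIidPr sFE). Qed.

Lemma net_split g o E F A : F \subset E ->
  net g o E A = net g o F A + net g o (E :\: F) A.
Proof. by move=> sFE; rewrite /net (big_setID F) /= (setIidPr sFE). Qed.

(* Splitting off the edges [e = xy] and [f = xw] replaces them by one edge [yw],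
   which is given the index [e]. *)
Definition split_off g e y w : ET -> V * V := fun h => if h == e then (y, w) else g h.

Section SplitOff.
Variables (g : ET -> V * V) (E : {set ET}) (e f : ET) (x y w : V).
Hypotheses (eE : e \in E) (fE : f \in E) (ef : e != f).
Hypotheses (e_xy : has_ends g e x y) (f_xw : has_ends g f x w).

Lemma delta_split_off h A : h != e -> delta (split_off g e y w) h A = delta g h A.
Proof. by rewrite /delta /split_off => /negPf->. Qed.

Lemma delta_split_off_eq A :
  delta (split_off g e y w) e A = (y \in A)%:Z - (w \in A)%:Z.
Proof. by rewrite /delta /split_off eqxx. Qed.

Lemma cut_split_off A :
  cut g E A = cut (split_off g e y w) (E :\ f) A
    + `|(x \in A)%:Z - (y \in A)%:Z| + `|(x \in A)%:Z - (w \in A)%:Z|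
    - `|(y \in A)%:Z - (w \in A)%:Z|.
Proof.
have eEf : e \in E :\ f by rewrite !inE ef.
rewrite (cut_setD1 _ _ fE) (cut_setD1 _ _ eEf) [in RHS](cut_setD1 _ _ eEf).
rewrite (delta_ends _ e_xy) (delta_ends _ f_xw) delta_split_off_eq.
have -> : cut (split_off g e y w) (E :\ f :\ e) A = cut g (E :\ f :\ e) A.
  by apply: eq_bigr => h; rewrite !inE => /andP[he _]; rewrite delta_split_off.
by lia.
Qed.

Lemma cut_split_off_parity A :
  (2 %| cut g E A - cut (split_off g e y w) (E :\ f) A)%Z.
Proof.
rewrite cut_split_off; move: (cut _ _ A) => m.
by case: (x \in A); case: (y \in A); case: (w \in A); lia.
Qed.

Lemma cut_split_off_le A : cut g E A <= cut (split_off g e y w) (E :\ f) A + 2.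
Proof.
rewrite cut_split_off; move: (cut _ _ A) => m.
by case: (x \in A); case: (y \in A); case: (w \in A); lia.
Qed.

Lemma cut_split_off_eq v : x != v -> y != w ->
  cut g E [set v] = cut (split_off g e y w) (E :\ f) [set v].
Proof.
rewrite cut_split_off !inE => /negPf-> yw; move: (cut _ _ _) => m.
by have [yv|_] := eqVneq y v; have [wv|_] := eqVneq w v; rewrite ?yv ?wv ?eqxx // in yw *; lia.
Qed.

Lemma cut_split_off_center : y != x -> w != x ->
  cut g E [set x] = cut (split_off g e y w) (E :\ f) [set x] + 2.
Proof.
by rewrite cut_split_off !inE eqxx => /negPf-> /negPf->; lia.
Qed.

Lemma ends_in_split_off W : ends_in g E W -> ends_in (split_off g e y w) (E :\ f) W.
Proof.
move=> gW h; rewrite !inE /split_off => /andP[_ hE]; case: eqP => [_|_]; last exact: gW.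
by split; [case: (has_ends_in gW eE e_xy) | case: (has_ends_in gW fE f_xw)].
Qed.

(** The direction of the new edge is lifted to the path [y], [x], [w]. The two contributions of [x]
    cancel, so no net out-degree changes. *)
Lemma signing_split_off o' : signing o' ->
  exists2 o, signing o & forall A, net g o E A = net (split_off g e y w) o' (E :\ f) A.
Proof.
move=> so'.
pose se : int := if g e == (y, x) then 1 else -1.
pose sf : int := if g f == (x, w) then 1 else -1.
exists (fun h => if h == e then se * o' e else if h == f then sf * o' e else o' h).
  by move=> h; have := so' e; have := so' h; rewrite /se /sf; do 3?case: ifP => _; lia.
move=> A; have eEf : e \in E :\ f by rewrite !inE ef.
rewrite (net_setD1 _ _ _ fE) (net_setD1 _ _ _ eEf) [in RHS](net_setD1 _ _ _ eEf).
rewrite eqxx eq_sym (negPf ef) eqxx delta_split_off_eq.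
rewrite addrA; congr (_ + _); last first.
  apply: eq_net_ends => h; rewrite !inE => /and3P[he hf _].
  by rewrite (negPf he) (negPf hf) delta_split_off.
have -> : se * o' e * delta g e A = o' e * ((y \in A)%:Z - (x \in A)%:Z).
  rewrite /se /delta; case: e_xy => -> /=; rewrite ?eqxx ?mul1r //.
  (* The test for the reversed pair can succeed here too, but only for a loop, which contributes
     0. *)
  by case: eqP => [[-> _]|_]; rewrite ?subrr ?mulr0 // mulN1r mulNr -mulrN opprB.
have -> : sf * o' e * delta g f A = o' e * ((x \in A)%:Z - (w \in A)%:Z).
  rewrite /sf /delta; case: f_xw => -> /=; rewrite ?eqxx ?mul1r //.
  by case: eqP => [[-> _]|_]; rewrite ?subrr ?mulr0 // mulN1r mulNr -mulrN opprB.
by rewrite -mulrDr; congr (_ * _); lia.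
Qed.

End SplitOff.

(** Two nonloop edges sharing a vertex are split off until the nonloop edges form a matching. There
    any signing is balanced, and lifting it back preserves net out-degrees. *)
Lemma balanced_signing g E :
  exists2 o, signing o & forall v, `|net g o E [set v]| <= 1.
Proof.
have [n] := ubnP #|E|; elim: n g E => // n IHn g E leEn.
have [/exists_inP[e eE /exists_inP[f fE /andP[ef /existsP[x /andP[dex dfx]]]]]|none] :=
  boolP [exists e in E, exists f in E, (e != f) &&
    [exists x, (delta g e [set x] != 0) && (delta g f [set x] != 0)]].
  have [y e_xy _] := incident_ends dex; have [w f_xw _] := incident_ends dfx.
  have [|o' so' bal] := IHn (split_off g e y w) (E :\ f).
    by move: leEn; rewrite (cardsD1 f E) fE.
  have [o so oE] := signing_split_off eE fE ef e_xy f_xw so'.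
  by exists o => // v; rewrite oE.
exists (fun=> 1); first by move=> e; left.
move=> v; have [/exists_inP[e eE dev]|none_v] := boolP [exists e in E, delta g e [set v] != 0].
  rewrite (net_setD1 _ _ _ eE) /net big1 ?addr0.
    by rewrite mul1r /delta; lia.
  move=> f; rewrite !inE => /andP[fe fE]; rewrite mul1r; apply/eqP/negPn/negP => dfv.
  case/negP: none; apply/exists_inP; exists e => //; apply/exists_inP; exists f => //.
  by rewrite eq_sym fe /=; apply/existsP; exists v; rewrite dev.
rewrite /net big1 // => e eE; rewrite mul1r; apply/eqP/negPn/negP => dev.
by case/negP: none_v; apply/exists_inP; exists e.
Qed.

(** Greedy choice: the removed term moves the target towards 0. A target 0 becomes 1, which is in
    range because parity leaves at least one further term. *)
Lemma signed_sum_reach (F : {set ET}) (d : ET -> int) (tau : int) :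
    (forall e, e \in F -> `|d e| = 1) -> `|tau| <= #|F|%:Z -> (2 %| tau - #|F|%:Z)%Z ->
  exists2 o, signing o & \sum_(e in F) o e * d e = tau.
Proof.
have [n] := ubnP #|F|; elim: n F tau => // n IHn F tau ltFn d1 le_tau par.
have [F0|[e eF]] := set_0Vmem F.
  exists (fun=> 1); first by left.
  by move: le_tau; rewrite F0 cards0 big_set0; lia.
have cF : #|F| = #|F :\ e|.+1 by rewrite (cardsD1 e) eF.
pose t : int := if 0 < tau then 1 else -1.
have tE : 0 < tau /\ t = 1 \/ tau <= 0 /\ t = -1 by rewrite /t; case: ltrP; auto.
have [||||o so oE] := IHn (F :\ e) (tau - t).
- by lia.
- by move=> f; rewrite inE => /andP[_]; exact: d1.
- by lia.
- by lia.
exists (fun f => if f == e then t * d e else o f).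
  by move=> f; have := d1 e eF; case: eqP => // _; lia.
rewrite (big_setD1 e) //= eqxx -mulrA -expr2 -real_normK ?num_real // d1 // expr1n mulr1.
rewrite (eq_bigr (fun f => o f * d f)); last first.
  by move=> f; rewrite !inE => /andP[/negPf->].
by rewrite oE; lia.
Qed.

Lemma cut_card g E A : cut g E A = #|[set e in E | delta g e A != 0]|%:Z.
Proof.
rewrite /cut -[RHS]natz -sum1_card natr_sum big_mkcond [RHS]big_mkcond /=.
apply: eq_bigr => e _; rewrite inE; case: (e \in E) => //=.
by rewrite /delta; case: (_ \in A); case: (_ \in A).
Qed.

Lemma reorient_at g o E v (tau : int) : signing o ->
    `|tau| <= cut g E [set v] -> (2 %| tau - cut g E [set v])%Z ->
  exists o', [/\ signing o', net g o' E [set v] = tau &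
    forall e, e \in E -> delta g e [set v] = 0 -> o' e = o e].
Proof.
move=> so; rewrite cut_card; set F := [set e in E | _] => le_tau par.
have [e|//|//|o1 so1 o1E] := @signed_sum_reach F (fun e => delta g e [set v]) tau.
  by rewrite inE => /andP[_]; rewrite /delta; case: (_ \in _); case: (_ \in _).
exists (fun e => if e \in F then o1 e else o e); split=> [e||e eE de].
- by case: ifP.
- rewrite -o1E /net big_mkcond [RHS]big_mkcond /=; apply: eq_bigr => e _.
  by rewrite inE; case: (e \in E) => //=; case: eqP => //= ->; rewrite mulr0.
by rewrite inE eE de eqxx.
Qed.

End Cuts.

(** * Orientations with prescribed net out-degrees modulo 2k *)

Section Contraction.
Variables V ET : finType.
Implicit Types (g : ET -> V * V) (E : {set ET}) (A B W : {set V}).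
Implicit Types (b : V -> int) (phi : V -> V).

(** Vertices are replaced by representatives while edge indices are kept; edges inside a fibre
    become loops, which cuts do not see. *)
Definition contract phi g : ET -> V * V := fun e => (phi (g e).1, phi (g e).2).
Definition fiber phi W B : {set V} := [set u in W | phi u \in B].
Definition push phi W b : V -> int := fun v => weight b (fiber phi W [set v]).

Lemma weight_push phi W b B : weight (push phi W b) B = weight b (fiber phi W B).
Proof.
rewrite /weight [RHS](partition_big phi (mem B)) /=; last by move=> u; rewrite inE => /andP[].
apply: eq_bigr => v vB; apply: eq_bigl => u; rewrite !inE.
by case: eqP => [->|]; rewrite ?vB ?andbT ?andbF.
Qed.

Lemma delta_contract phi g E W e B : ends_in g E W -> e \in E ->
  delta (contract phi g) e B = delta g e (fiber phi W B).
Proof. by move=> gW /gW[uW vW]; rewrite /delta /contract /= !inE uW vW. Qed.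

Lemma cut_contract phi g E W B : ends_in g E W ->
  cut (contract phi g) E B = cut g E (fiber phi W B).
Proof. by move=> gW; apply: eq_bigr => e eE; rewrite (delta_contract phi B gW eE). Qed.

Lemma net_contract phi g o E W B : ends_in g E W ->
  net (contract phi g) o E B = net g o E (fiber phi W B).
Proof. by move=> gW; apply: eq_bigr => e eE; rewrite (delta_contract phi B gW eE). Qed.

Lemma ends_in_contract phi g E W : ends_in g E W -> ends_in (contract phi g) E (phi @: W).
Proof. by move=> gW e /gW[uW vW]; split; apply: imset_f. Qed.

Lemma fiber_sub phi W B : fiber phi W B \subset W.
Proof. by apply/subsetP => u; rewrite inE => /andP[]. Qed.

Lemma fiber_eq0 phi W B : B \subset phi @: W -> (fiber phi W B == set0) = (B == set0).
Proof.
move=> /subsetP sB; apply/eqP/eqP => [F0|->]; last first.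
  by apply/setP => u; rewrite !inE andbF.
apply/setP => v; rewrite inE; apply/negP => vB; have /imsetP[u uW vu] := sB _ vB.
by move/setP/(_ u): F0; rewrite !inE uW -vu vB.
Qed.

Lemma fiber_eq_full phi W B : B \subset phi @: W -> (fiber phi W B == W) = (B == phi @: W).
Proof.
move=> sB; apply/eqP/eqP => [FW|->].
  apply/eqP; rewrite eqEsubset sB; apply/subsetP => _ /imsetP[u uW ->].
  by move: uW; rewrite -{1}FW inE => /andP[].
by apply/setP => u; rewrite inE; case uW: (u \in W) => //=; rewrite imset_f.
Qed.

Definition collapse A (a v : V) : V := if v \in A then a else v.

Lemma fiber_collapse_in A a W B : A \subset W -> a \in A -> a \in B ->
  A \subset fiber (collapse A a) W B.
Proof.
move=> /subsetP sAW aA aB; apply/subsetP => u uA.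
by rewrite inE sAW // /collapse uA.
Qed.

Lemma fiber_collapse_notin A a W B : a \in A -> a \notin B ->
  B \subset collapse A a @: W -> fiber (collapse A a) W B = B /\ [disjoint B & A].
Proof.
move=> aA aB /subsetP sB.
have BP u : u \in B -> u \in W /\ u \notin A.
  move=> uB; have /imsetP[v vW] := sB _ uB; rewrite /collapse.
  by case: ifP => [_ ua|vA ->]; [rewrite -ua uB in aB | rewrite vA].
split; last first.
  by apply/pred0P => u /=; case uB: (u \in B) => //=; rewrite (negPf (BP _ uB).2).
apply/setP => u; rewrite inE /collapse; case: ifP => uA.
  rewrite (negPf aB) andbF; apply/esym; apply: contraTF uA => uB.
  by rewrite (BP _ uB).2.
by case uB: (u \in B); rewrite ?andbF ?andbT //; case: (BP _ uB).
Qed.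

Lemma fiber_collapse1 A a W v : a \in A -> v \in W :\: A ->
  fiber (collapse A a) W [set v] = [set v].
Proof.
rewrite inE => aA /andP[vA vW]; apply/setP => u; rewrite !inE /collapse.
case: ifP => uA; last by case: eqP => [->|]; rewrite ?vW ?andbF.
have -> : (a == v) = false by apply: contraNF vA => /eqP<-.
by rewrite andbF; apply/esym; apply: contraNF vA => /eqP<-.
Qed.

Lemma fiber_collapse_center A a W : A \subset W -> a \in A ->
  fiber (collapse A a) W [set a] = A.
Proof.
move=> /subsetP sAW aA; apply/setP => u; rewrite !inE /collapse.
case: ifP => uA; first by rewrite sAW ?eqxx.
by rewrite andbC; case: eqP => // ua; rewrite -ua uA in aA.
Qed.

Lemma card_collapse A a W : A \subset W -> a \in A -> (1 < #|A|)%N ->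
  (#|collapse A a @: W| < #|W|)%N.
Proof.
move=> sAW aA A1; have sub : collapse A a @: W \subset a |: (W :\: A).
  apply/subsetP => _ /imsetP[u uW ->]; rewrite !inE /collapse.
  by case: ifP => uA; rewrite ?eqxx // uA uW orbT.
have aWA : a \notin W :\: A by rewrite inE aA.
have := subset_leq_card sub; rewrite cardsU1 aWA cardsD (setIidPr sAW).
by have := subset_leq_card sAW; lia.
Qed.

End Contraction.

(** * The cut condition and the reduction at tight cuts *)

Section Orientations.
Variables (k : nat) (V ET : finType).
Hypothesis k_gt1 : (1 < k)%N.
Notation K := (2 * k)%:Z.
Notation dist := (dist_mul k).
Implicit Types (g : ET -> V * V) (e f : ET) (E : {set ET}) (A B W X : {set V}).
Implicit Types (x y v w : V) (o : ET -> int) (b c s : V -> int).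

Let k_gt0 : (0 < k)%N. Proof. exact: ltnW. Qed.

Definition solvable g E W c : Prop :=
  exists2 o, signing o & forall v, v \in W -> (K %| net g o E [set v] - c v)%Z.

(* [c] is the prescribed net out-degree modulo [2k]. The graph comes with [s v]
   further edges joining [v] to a root outside [W]; these are already oriented,
   and [b v - c v] is their net contribution at [v]. The set [X] is empty or
   consists of one vertex of residue 0, which is exempt from the cut condition. *)
Record valid g E W b c s X : Prop := Valid {
  valid_ends : ends_in g E W;
  valid_root_edges : forall v, v \in W -> `|b v - c v| <= s v;
  valid_parity_c : forall v, v \in W -> (2 %| cut g E [set v] - c v)%Z;
  valid_parity_b : forall v, v \in W -> (2 %| cut g E [set v] + s v - b v)%Z;
  valid_sum : (K %| weight c W)%Z;
  valid_exempt : X = set0 \/ exists x, [/\ X = [set x], x \in W & (K %| b x)%Z];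
  valid_root : weight s W <= K - 2 + dist (weight b W);
  valid_cut : forall A, A \subset W -> A != set0 -> A != W -> A != X ->
    K - 2 + dist (weight b A) <= cut g E A + weight s A
}.

Lemma parity_c_set g E W b c s X A : valid g E W b c s X -> A \subset W ->
  (2 %| cut g E A - weight c A)%Z.
Proof.
by move=> val /subsetP sAW; apply: parity_cut_weight => v /sAW; apply: valid_parity_c val v.
Qed.

Lemma parity_b_set g E W b c s X A : valid g E W b c s X -> A \subset W ->
  (2 %| cut g E A + weight s A - weight b A)%Z.
Proof.
move=> val /subsetP sAW.
have -> : cut g E A + weight s A - weight b A = cut g E A - weight (fun v => b v - s v) A.
  by rewrite -weightB; lia.
by apply: parity_cut_weight => v /sAW /(valid_parity_b val); lia.
Qed.

Lemma weight_root_ge0 g E W b c s X A : valid g E W b c s X -> A \subset W ->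
  0 <= weight s A.
Proof.
move=> val /subsetP sAW; apply: weight_ge0 => v /sAW /(valid_root_edges val).
exact: le_trans.
Qed.

Lemma solvable_small g E W c : ends_in g E W -> (K %| weight c W)%Z -> (#|W| <= 1)%N ->
  solvable g E W c.
Proof.
move=> gW cW W1; exists (fun=> 1); first by left.
move=> v vW; have defW : W = [set v].
  by apply/eqP; rewrite eq_sym eqEcard sub1set vW cards1.
by rewrite -defW (net_full _ gW) sub0r rpredN; move: cW; rewrite defW weight1.
Qed.

(** Cuts of the contraction are the cuts of the graph that respect the fibres, so all conditions are
    inherited; [X'] has to capture every set whose preimage is [X]. *)
Lemma valid_contract phi g E W b c s X X' : valid g E W b c s X ->
    (forall B, B \subset phi @: W -> fiber phi W B = X -> B = X') ->
    (X' = set0 \/ exists x, [/\ X' = [set x], x \in phi @: W & (K %| push phi W b x)%Z]) ->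
  valid (contract phi g) E (phi @: W) (push phi W b) (push phi W c) (push phi W s) X'.
Proof.
move=> val fX exX'; have gW := valid_ends val.
have fW : fiber phi W (phi @: W) = W by apply/eqP; rewrite fiber_eq_full.
split=> //.
- exact: ends_in_contract.
- move=> v _; rewrite /push weightB; apply: weight_norm_le => u uF.
  by apply: (valid_root_edges val); apply: (subsetP (fiber_sub phi W [set v])).
- by move=> v _; rewrite (cut_contract _ _ gW) /push; apply: parity_c_set val (fiber_sub _ _ _).
- by move=> v _; rewrite (cut_contract _ _ gW) /push; apply: parity_b_set val (fiber_sub _ _ _).
- by rewrite weight_push fW; apply: valid_sum val.
- by rewrite !weight_push fW; apply: valid_root val.
move=> B sB B0 BW BX; rewrite !weight_push (cut_contract _ _ gW); apply: (valid_cut val).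
- exact: fiber_sub.
- by rewrite fiber_eq0.
- by rewrite fiber_eq_full.
- by apply: contraNneq BX => /(fX _ sB)->.
Qed.

Lemma solvable_contract g E W c A a : ends_in g E W -> A \subset W -> a \in A ->
    solvable (contract (collapse A a) g) E (collapse A a @: W) (push (collapse A a) W c) ->
  exists o, [/\ signing o, forall v, v \in W :\: A -> (K %| net g o E [set v] - c v)%Z
    & (K %| net g o E A - weight c A)%Z].
Proof.
move=> gW sAW aA [o so oc]; exists o; split=> // [v vWA|].
  have /setDP[vW vA] := vWA.
  have := oc v; rewrite (net_contract _ _ _ gW) /push fiber_collapse1 // weight1; apply.
  by apply/imsetP; exists v; rewrite // /collapse (negPf vA).
have := oc a; rewrite (net_contract _ _ _ gW) /push fiber_collapse_center //; apply.
by apply/imsetP; exists a; rewrite ?(subsetP sAW) // /collapse aA.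
Qed.

Definition inner g E A : {set ET} := [set e in E | ((g e).1 \in A) && ((g e).2 \in A)].

Lemma inner_sub g E A : inner g E A \subset E.
Proof. by apply/subsetP => e; rewrite inE => /andP[]. Qed.

Lemma delta_inner g E A e B : [disjoint B & A] -> e \in inner g E A -> delta g e B = 0.
Proof.
move=> dBA; rewrite inE => /and3P[_ uA vA].
by rewrite /delta !(disjointFl dBA).
Qed.

Lemma delta_inner_full g E A e : e \in inner g E A -> delta g e A = 0.
Proof. by rewrite inE => /and3P[_ uA vA]; rewrite /delta uA vA. Qed.

(** An edge not inside [A] has at most one end in [B], so at most one term is nonzero. Hence such
    edges can be counted vertex by vertex, like root edges. *)
Lemma norm_delta_cross g E A e B : e \in E :\: inner g E A -> B \subset A ->
  \sum_(v in B) `|delta g e [set v]| = `|delta g e B|.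
Proof.
rewrite !inE => /andP[eI eE] /subsetP sBA; rewrite eE /= in eI.
have key u w : u \notin A -> \sum_(v in B) `|(u \in [set v])%:Z - (w \in [set v])%:Z|
     = `|(u \in B)%:Z - (w \in B)%:Z|.
  move=> uA; have uB : u \notin B by apply: contra uA; apply: sBA.
  have -> : `|(u \in B)%:Z - (w \in B)%:Z| = (w \in B)%:Z by rewrite (negPf uB); lia.
  rewrite (eq_bigr (fun v => (w == v)%:Z)) => [|v vB]; last first.
    rewrite !inE; have -> : (u == v) = false by apply: contraNF uB => /eqP->.
    by lia.
  have [wB|wB] := boolP (w \in B).
    rewrite (bigD1 w) //= eqxx big1 ?addr0 // => v /andP[_].
    by rewrite eq_sym => /negPf->.
  rewrite big1 // => v vB; case: eqP => // wv.
  by rewrite wv vB in wB.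
rewrite /delta; move: eI; rewrite negb_and => /orP[uA|vA]; first exact: key.
rewrite [RHS]distrC -(key _ _ vA); apply: eq_bigr => v _; exact: distrC.
Qed.

(* An orientation that is correct outside [A], and on [A] as a whole, extends:
   the edges leaving [A] become root edges for the graph inside [A]. *)
Lemma solvable_inner g E W b c s A X o :
    ends_in g E W -> A \subset W -> signing o ->
    (forall v, v \in W :\: A -> (K %| net g o E [set v] - c v)%Z) ->
    (K %| net g o E A - weight c A)%Z ->
    (forall v, v \in A -> `|b v - c v| <= s v) ->
    (forall v, v \in A -> (2 %| cut g E [set v] - c v)%Z) ->
    (forall v, v \in A -> (2 %| cut g E [set v] + s v - b v)%Z) ->
    (X = set0 \/ exists x, [/\ X = [set x], x \in A & (K %| b x)%Z]) ->
    cut g E A + weight s A <= K - 2 + dist (weight b A) ->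
    (forall B, B \subset A -> B != set0 -> B != A -> B != X ->
       K - 2 + dist (weight b B) <= cut g E B + weight s B) ->
    (forall c' s', valid g (inner g E A) A b c' s' X -> solvable g (inner g E A) A c') ->
  solvable g E W c.
Proof.
move=> gW sAW so outA onA rootA parc parb exX rootle cuts IH.
set I := inner g E A in IH *; have sIE : I \subset E by exact: inner_sub.
(* The edges not inside [A] keep their directions. Their contribution leaves the target and their
   number joins [s]; with [b] unchanged, [b - c'] records the old and new root edges together. *)
pose c' v := c v - net g o (E :\: I) [set v].
pose s' v := s v + cut g (E :\: I) [set v].
have ws' B : B \subset A -> weight s' B = weight s B + cut g (E :\: I) B.
  move=> sBA; rewrite /s' -weightD; congr (_ + _); rewrite /weight /cut exchange_big /=.
  by apply: eq_bigr => e eI; apply: norm_delta_cross eI sBA.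
have cI0 : cut g I A = 0.
  by rewrite /cut big1 // => e eI; rewrite (delta_inner_full eI) normr0.
have nI0 o' : net g o' I A = 0.
  by rewrite /net big1 // => e eI; rewrite (delta_inner_full eI) mulr0.
have dD B : B \subset A -> cut g I B + weight s' B = cut g E B + weight s B.
  by move=> /ws'->; rewrite [RHS]addrC (cut_split _ _ sIE); lia.
have [|o' so' o'c] := IH c' s'.
  split=> //.
  - by move=> e; rewrite inE => /and3P[].
  - move=> v vA; have := rootA v vA; rewrite /c' /s'.
    have : `|net g o (E :\: I) [set v]| <= cut g (E :\: I) [set v].
      apply: le_trans (ler_norm_sum _ _ _) _; apply: ler_sum => e _.
      by rewrite normrM; case: (so e) => ->; rewrite ?normrN normr1 mul1r.
    by lia.
  - move=> v /parc; rewrite /c' (cut_split _ _ sIE).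
    by have := parity_net g (E :\: I) [set v] so; lia.
  - by move=> v /parb; rewrite /s' (cut_split _ _ sIE); lia.
  - have -> : weight c' A = - (net g o E A - weight c A).
      by rewrite /c' -weightB -net_weight (net_split _ _ _ sIE) nI0; lia.
    by rewrite rpredN.
  (* No inner edge crosses [A], so the root bound is the assumed upper bound on the edges leaving
     [A]. *)
  - by rewrite -(add0r (weight _ _)) -[X in X + _]cI0 dD.
  by move=> B sBA B0 BA BX; rewrite dD //; apply: cuts.
exists (fun e => if e \in I then o' e else o e); first by move=> e; case: ifP.
have netE v : net g (fun e => if e \in I then o' e else o e) E [set v] =
    net g o' I [set v] + net g o (E :\: I) [set v].
  rewrite (net_split _ _ _ sIE); congr (_ + _); apply: eq_net_ends => e.
    by move=> ->.
  by rewrite inE => /andP[/negPf->].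
move=> v vW; rewrite netE; have [vA|vA] := boolP (v \in A).
  by have := o'c v vA; rewrite /c'; congr (dvdz _ _); lia.
have dvA : [disjoint [set v] & A] by rewrite disjoints1.
have nI o'' : net g o'' I [set v] = 0.
  by rewrite /net big1 // => e eI; rewrite (delta_inner dvA eI) mulr0.
rewrite nI; have := outA v; rewrite inE vA vW (net_split _ _ _ sIE) nI => /(_ isT).
by [].
Qed.

Definition solvable_below n := forall g E W b c s X,
  valid g E W b c s X -> (#|W| + #|E| < n)%N -> solvable g E W c.

(** The contraction of [A] is solved first, then the inside of [A] with the crossing edges fixed;
    tightness is the root bound there. The exempt vertex goes to the part that contains it. *)
Lemma solvable_tight g E W b c s X A : valid g E W b c s X ->
    solvable_below (#|W| + #|E|) -> A \subset W -> (1 < #|A|)%N -> A != W ->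
    cut g E A + weight s A <= K - 2 + dist (weight b A) ->
  solvable g E W c.
Proof.
move=> val IH sAW A1 AW tightA; have gW := valid_ends val.
have /card_gt0P[a aA] : (0 < #|A|)%N by exact: ltnW.
have aW := subsetP sAW _ aA.
have [|o [so outA onA]] := solvable_contract (c := c) gW sAW aA.
  apply: (IH _ _ _ (push (collapse A a) W b) _ (push (collapse A a) W s) (X :\: A)).
    apply: (valid_contract val) => [B sB fB|].
      (* A set containing [a] has a preimage with at least two vertices, which is not the exempt
         set. *)
      have [aB|aB] := boolP (a \in B); last first.
        have [fBB dBA] := fiber_collapse_notin aA aB sB.
        by rewrite -fB fBB; apply/esym/setDidPl.
      have := subset_leq_card (fiber_collapse_in sAW aA aB); rewrite fB.
      case: (valid_exempt val) => [->|[x [-> _ _]]].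
        by rewrite cards0; lia.
      by rewrite cards1; lia.
    case: (valid_exempt val) => [->|[x [-> xW bx]]]; first by left; rewrite set0D.
    have [xA|xA] := boolP (x \in A).
      by left; apply/eqP; rewrite setD_eq0 sub1set.
    right; exists x; split.
    - by apply/setDidPl; rewrite disjoints1.
    - by apply/imsetP; exists x; rewrite // /collapse (negPf xA).
    - by rewrite /push fiber_collapse1 ?weight1 // inE xA.
  by rewrite ltn_add2r; apply: card_collapse.
apply: (solvable_inner (b := b) (s := s) (X := X :&: A) (o := o) gW sAW) => //.
- by move=> v /(subsetP sAW); apply: valid_root_edges val _.
- by move=> v /(subsetP sAW); apply: valid_parity_c val _.
- by move=> v /(subsetP sAW); apply: valid_parity_b val _.
- case: (valid_exempt val) => [->|[x [-> xW bx]]]; first by left; rewrite set0I.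
  have [xA|xA] := boolP (x \in A); last by left; apply/eqP; rewrite setI_eq0 disjoints1.
  by right; exists x; split=> //; apply/setIidPl; rewrite sub1set.
- move=> B sBA B0 BA BX; apply: (valid_cut val) => //; first exact: subset_trans sAW.
    apply: contraNneq BA => BW; rewrite eqEsubset sBA /= -BW in sAW *.
    by rewrite sAW.
  by apply: contraNneq BX => BX; rewrite -BX; apply/eqP/esym/setIidPl.
- move=> c' s' val'; apply: (IH _ _ _ _ _ _ _ val').
  have := subset_leq_card (inner_sub g E A); have : (#|A| < #|W|)%N.
    by rewrite ltn_neqAle subset_leq_card // andbT; apply: contraNneq AW => cA;
       rewrite eqEcard sAW cA leqnn.
  by lia.
Qed.

(** Both sides of the cut condition have the same parity, so a set that is not tight has two edges
    to spare. *)
Lemma solvable_tight_or_slack g E W b c s X : valid g E W b c s X ->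
    solvable_below (#|W| + #|E|) ->
  solvable g E W c \/ forall A, A \subset W -> (1 < #|A|)%N -> A != W ->
    K + dist (weight b A) <= cut g E A + weight s A.
Proof.
move=> val IH; have [/existsP[A /and4P[sAW A1 AW tight]]|none] := boolP [exists A : {set V},
    [&& A \subset W, (1 < #|A|)%N, A != W &
      cut g E A + weight s A <= K - 2 + dist (weight b A)]].
  by left; exact: (solvable_tight val IH sAW A1 AW tight).
right=> A sAW A1 AW; have := parity_b_set val sAW; have := dist_mul_parity k_gt0 (weight b A).
have: ~~ (cut g E A + weight s A <= K - 2 + dist (weight b A)).
  by apply: contra none => tight; apply/existsP; exists A; rewrite sAW A1 AW.
by lia.
Qed.

(** * The induction step without tight cuts *)

Definition accepts g E b s v (h : int) : bool :=
  (K + dist (b v) <= cut g E [set v] + s v) || (dist (b v - h) == dist (b v) - 1).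

(** A vertex that accepts [h] can lose an edge contributing [h] to its net out-degree: either it has
    slack 2, or its distance drops together with its degree. *)
Lemma accepts_bound g E b s v h : h = 1 \/ h = -1 -> accepts g E b s v h ->
  K - 2 + dist (b v) <= cut g E [set v] + s v ->
  K - 2 + dist (b v - h) <= cut g E [set v] + s v - 1.
Proof.
move=> h1 /orP[]; last by move=> /eqP->; lia.
by have := dist_mulD k_gt0 (b v) (- h); lia.
Qed.

Lemma has_ends_signed g e x y : has_ends g e x y ->
  exists2 h : int, h = 1 \/ h = -1 & forall A, h * delta g e A = (x \in A)%:Z - (y \in A)%:Z.
Proof.
by rewrite /delta => -[->|->] /=; [exists 1|exists (-1)]; auto => A; rewrite ?mulN1r ?mul1r ?opprB.
Qed.

Lemma card_gt1_or_set1 A : A != set0 -> (1 < #|A|)%N \/ exists v, A = [set v].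
Proof.
by rewrite -card_gt0 leq_eqVlt eq_sym => /orP[/cards1P|]; [right | left].
Qed.

(** The edge is directed from [x] to [y] and deleted, with [b] and [c] corrected at both ends.
    Larger sets rely on their slack, the singletons of [x] and [y] on [accepts]. *)
Lemma solvable_edge g E W b c s e x y : valid g E W b c s set0 ->
    solvable_below (#|W| + #|E|) -> e \in E -> has_ends g e x y -> x != y ->
    accepts g E b s x 1 -> accepts g E b s y (-1) ->
  solvable g E W c.
Proof.
move=> val IH eE exy xy accx accy; have gW := valid_ends val.
have [//|slack] := solvable_tight_or_slack val IH.
have [h hs hE] := has_ends_signed exy.
have [xW yW] := has_ends_in gW eE exy.
pose upd b v : int := b v + (v == x)%:Z * -1 + (v == y)%:Z * 1.
have wu b' A : weight (upd b') A = weight b' A - (x \in A)%:Z + (y \in A)%:Z.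
  by rewrite /upd !weight_upd; lia.
have ce A : cut g E A = `|(x \in A)%:Z - (y \in A)%:Z| + cut g (E :\ e) A.
  by rewrite (cut_setD1 _ _ eE) (delta_ends _ exy).
have valE : valid g (E :\ e) W (upd b) (upd c) s set0.
  split=> //.
  - by move=> f; rewrite inE => /andP[_]; apply: gW.
  - by move=> v /(valid_root_edges val); rewrite /upd; lia.
  - move=> v /(valid_parity_c val); rewrite /upd ![v == _]eq_sym ce !inE; clear.
    by case: (x == v); case: (y == v); lia.
  - move=> v /(valid_parity_b val); rewrite /upd ![v == _]eq_sym ce !inE; clear.
    by case: (x == v); case: (y == v); lia.
  - by rewrite wu xW yW subrK; apply: valid_sum val.
  - by left.
  - by rewrite wu xW yW subrK; apply: valid_root val.
  move=> A sAW A0 AW _; case: (card_gt1_or_set1 A0) => [A1|[v defA]].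
    rewrite (wu b); have := slack A sAW A1 AW; rewrite ce.
    have := dist_mul_shift k_gt0 (weight b A) (x \in A) (y \in A).
    by move: (weight b A) (x \in A) (y \in A) => m p q; move: (dist _) => d; clear; lia.
  have := valid_cut val sAW A0 AW A0; rewrite (wu b) defA !weight1 !inE.
  have yx : (y == x) = false by rewrite eq_sym (negPf xy).
  have [<-|xv] := eqVneq x v.
    have cx : cut g E [set x] = 1 + cut g (E :\ e) [set x] by rewrite ce !inE eqxx yx.
    move/(accepts_bound (or_introl erefl) accx); rewrite cx yx.
    rewrite (_ : b x - true%:Z + false%:Z = b x - 1) ?addr0 //.
    by clear; lia.
  have [<-|yv] := eqVneq y v; last first.
    by rewrite /= subr0 addr0 ce !inE (negPf xv) (negPf yv) add0r.
  have cy : cut g E [set y] = 1 + cut g (E :\ e) [set y] by rewrite ce !inE eqxx (negPf xy).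
  move/(accepts_bound (or_intror erefl) accy); rewrite cy opprK.
  rewrite (_ : b y - false%:Z + true%:Z = b y + 1) ?subr0 //.
  by move: (dist (b y + 1)) => d; clear; lia.
have [|o so oc] := IH _ _ _ _ _ _ _ valE.
  by rewrite ltn_add2l [in X in (_ < X)%N](cardsD1 e) eE.
exists (fun f => if f == e then h else o f); first by move=> f; case: eqP.
move=> v vW; have := oc v vW; rewrite (net_setD1 _ _ _ eE) eqxx hE /upd !inE ![v == _]eq_sym.
rewrite (@eq_net_ends _ _ g g _ o); last by move=> f; rewrite !inE => /andP[/negPf->].
by congr (dvdz _ _); clear; lia.
Qed.

(** Edges from [x] to two different neighbours are split off; this keeps the cuts of all other
    single vertices. Otherwise all nonloop edges at [x] lead to one vertex [y]: the pair is
    contracted, and afterwards these edges are redirected to give [x] its target. *)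
Lemma solvable_exempt g E W b c s x : valid g E W b c s [set x] ->
    solvable_below (#|W| + #|E|) ->
  solvable g E W c.
Proof.
move=> val IH; have gW := valid_ends val.
have [xW bx] : x \in W /\ (K %| b x)%Z.
  case: (valid_exempt val) => [x0|[v [/set1_inj<- ]]] //.
  by move/setP/(_ x): x0; rewrite !inE eqxx.
have [//|slack] := solvable_tight_or_slack val IH.
have [W1|W1] := leqP #|W| 1; first exact: solvable_small gW (valid_sum val) W1.
pose two e f y w := [&& e \in E, f \in E, y != x, w != x, y != w,
  (g e == (x, y)) || (g e == (y, x)) & (g f == (x, w)) || (g f == (w, x))].
have [/existsP[e /existsP[f /existsP[y /existsP[w]]]]|none] :=
    boolP [exists e, exists f, exists y, exists w, two e f y w].
  case/and5P=> eE fE yx wx /and3P[yw exy fxw].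
  have {}exy : has_ends g e x y by case/orP: exy => /eqP; [left | right].
  have {}fxw : has_ends g f x w by case/orP: fxw => /eqP; [left | right].
  have ef : e != f.
    apply: contraNneq yw => ef; move: exy fxw; rewrite -ef /has_ends => exy exw.
    by apply/eqP; case: exy exw => -> []; congruence.
  have [||o' so' o'c] := IH (split_off g e y w) (E :\ f) W b c s [set x]; last 2 first.
  - by rewrite ltn_add2l [in X in (_ < X)%N](cardsD1 f) fE.
  - have [o so oE] := signing_split_off eE fE ef exy fxw so'.
    by exists o => // v /o'c; rewrite oE.
  split.
  - exact: (ends_in_split_off eE fE exy fxw gW).
  - exact: valid_root_edges val.
  - move=> v /(valid_parity_c val); have := cut_split_off_parity eE fE ef exy fxw [set v].
    by clear; lia.
  - move=> v /(valid_parity_b val); have := cut_split_off_parity eE fE ef exy fxw [set v].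
    by clear; lia.
  - exact: valid_sum val.
  - exact: valid_exempt val.
  - exact: valid_root val.
  move=> A sAW A0 AW AX; have [A1|[v defA]] := card_gt1_or_set1 A0.
    have := slack A sAW A1 AW; have := cut_split_off_le eE fE ef exy fxw A.
    by clear; lia.
  have xv : x != v by apply: contraNneq AX => ->; rewrite defA.
  have := valid_cut val sAW A0 AW AX.
  by rewrite defA (cut_split_off_eq eE fE ef exy fxw xv yw).
have [y [yW yx onlyy]] : exists y, [/\ y \in W, y != x &
    forall e, e \in E -> delta g e [set x] != 0 -> has_ends g e x y].
  have [/exists_inP[e eE de]|noedge] := boolP [exists e in E, delta g e [set x] != 0].
    have [y exy yx] := incident_ends de; exists y; split=> //.
      by case: (has_ends_in gW eE exy).
    move=> f fE df; have [w fxw wx] := incident_ends df.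
    have [<- //|yw] := eqVneq w y.
    case/negP: none; apply/existsP; exists e; apply/existsP; exists f.
    apply/existsP; exists y; apply/existsP; exists w.
    rewrite /two eE fE yx wx eq_sym yw /=.
    by apply/andP; split; [case: exy | case: fxw] => ->; rewrite eqxx ?orbT.
  (* If [x] has no nonloop edge, any other vertex can serve as [y]. *)
  have : W :\ x != set0 by rewrite -card_gt0; move: W1; rewrite (cardsD1 x) xW.
  case/set0Pn=> y; rewrite !inE => /andP[yx yW]; exists y; split=> // e eE de.
  by case/negP: noedge; apply/exists_inP; exists e.
set A := [set x; y].
have sAW : A \subset W by apply/subsetP => v; rewrite !inE => /orP[] /eqP->.
have cA : #|A| = 2%N by rewrite cards2 eq_sym yx.
have [yA xA] : y \in A /\ x \in A by rewrite !inE !eqxx orbT.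
have [|o [so outA onA]] := solvable_contract (c := c) gW sAW yA.
  apply: (IH _ _ _ (push (collapse A y) W b) _ (push (collapse A y) W s) set0).
    apply: (valid_contract val) => [B sB fB|]; last by left.
    have [yB|yB] := boolP (y \in B).
      by have := subset_leq_card (fiber_collapse_in sAW yA yB); rewrite fB cA cards1.
    have [fBB /pred0P/(_ x) /=] := fiber_collapse_notin yA yB sB.
    by rewrite -fBB fB inE eqxx xA.
  by rewrite ltn_add2r; apply: card_collapse; rewrite // cA.
(* The cut condition for the complement of [x] is compared with the root bound; their distances
   agree since [b x] is a multiple of [2k]. *)
have cut_ge : s x <= cut g E [set x].
  have WxW : W :\ x \subset W by exact: subD1set.
  have /(valid_cut val WxW) : W :\ x != set0 by apply/set0Pn; exists y; rewrite !inE yx.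
  have WDx : W :\ x != W by apply: contraTneq xW => <-; rewrite !inE eqxx.
  move/(_ WDx); have -> : W :\ x != [set x].
    by apply: contraTneq yW => /setP/(_ y); rewrite !inE (negPf yx) /= => ->.
  move=> /(_ isT); rewrite cut_compl //.
  have sxW : [set x] \subset W by rewrite sub1set.
  have := valid_root val; rewrite (weight_setD s sxW) (weight_setD b sxW) !weight1.
  rewrite (@dist_mul_mod _ k_gt0 (b x + weight b (W :\ x)) (weight b (W :\ x))) ?addrK //.
  by clear; lia.
(* The value [c x - b x] is congruent to [c x], and it is within reach because its size is at most
   [s x]. *)
have [||o2 [so2 netx same]] := @reorient_at _ _ g o E x (c x - b x) so.
- by apply: le_trans cut_ge; rewrite distrC; apply: valid_root_edges val _ xW.
- have := valid_parity_c val xW; have : (2 %| b x)%Z.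
    by apply: dvdz_trans bx; rewrite PoszM dvdz_mulr.
  by clear; lia.
have same_net B : ((x \in B) = (y \in B)) -> net g o2 E B = net g o E B.
  move=> xyB; apply: eq_net_ends => e eE.
  have [/(same e eE)-> //|de] := eqVneq (delta g e [set x]) 0.
  have := delta_ends B (onlyy _ eE de); rewrite xyB subrr normr0 => /eqP.
  by rewrite normr_eq0 => /eqP->; rewrite !mulr0.
exists o2 => // v vW; have [vA|vA] := boolP (v \in A); last first.
  have := outA v; rewrite inE vA vW => /(_ isT); rewrite same_net //.
  by move: vA; rewrite !inE negb_or ![_ == v]eq_sym => /andP[/negPf-> /negPf->].
have netxb : (K %| net g o2 E [set x] - c x)%Z by rewrite netx addrAC subrr sub0r rpredN.
have [-> //|vx] := eqVneq v x.
have -> : v = y by move: vA; rewrite !inE (negPf vx) => /eqP.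
have wA (d : V -> int) : weight d A = d x + d y.
  by rewrite /weight big_setU1 ?inE 1?eq_sym // big_set1.
have := net_weight g o2 E A; rewrite same_net ?xA ?yA // wA => nA; rewrite nA wA in onA.
by have := rpredB onA netxb; congr (dvdz _ _); clear; lia.
Qed.

(** Adding the cut conditions of [A] and its complement and subtracting the root bound leaves
    [2k - 2] as a lower bound for twice the cut, by the triangle inequality. *)
Lemma valid_cut_gt0 g E W b c s A : valid g E W b c s set0 ->
  A \subset W -> A != set0 -> A != W -> 0 < cut g E A.
Proof.
move=> val sAW A0 AW; have gW := valid_ends val.
have DW : W :\: A \subset W by exact: subsetDl.
have D0 : W :\: A != set0.
  by rewrite setD_eq0; apply: contraNN AW => sWA; rewrite eqEsubset sAW.
have DW' : W :\: A != W.
  have /set0Pn[v vA] := A0; apply: contraTneq vA => DWA.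
  by apply/negP => vA; have := subsetP sAW v vA; rewrite -DWA inE vA.
have := valid_cut val DW D0 DW' D0; have := valid_cut val sAW A0 AW A0.
have := valid_root val; rewrite (weight_setD s sAW) (weight_setD b sAW) cut_compl //.
have := dist_mul_triangle k_gt0 (weight b A) (weight b (W :\: A)).
by lia.
Qed.

Lemma valid_neighbour g E W b c s v : valid g E W b c s set0 -> (1 < #|W|)%N -> v \in W ->
  exists e y, [/\ e \in E, has_ends g e v y, y \in W & y != v].
Proof.
move=> val W1 vW; have [|||e eE de] := cut_gt0 (@valid_cut_gt0 _ _ _ _ _ _ [set v] val _ _ _).
- by rewrite sub1set.
- by apply/set0Pn; exists v; rewrite inE.
- by apply: contraTneq W1 => <-; rewrite cards1.
have [y evy yv] := incident_ends de; exists e, y; split=> //.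
by case: (has_ends_in (valid_ends val) eE evy).
Qed.

(** The number of root edges at [x] changes by [j] and their contribution by [d], while [c] is kept.
    The bound [j + 2] on [d] is what the slack 2 of larger sets affords. *)
Lemma valid_update_root g E W b c s x (j d : int) : valid g E W b c s set0 ->
    (forall A, A \subset W -> (1 < #|A|)%N -> A != W ->
       K + dist (weight b A) <= cut g E A + weight s A) ->
    x \in W -> `|b x + d - c x| <= s x + j -> (2 %| j - d)%Z -> `|d| <= j + 2 ->
    weight s W + j <= K - 2 + dist (weight b W + d) ->
    K - 2 + dist (b x + d) <= cut g E [set x] + (s x + j) ->
  valid g E W (fun v => b v + (v == x)%:Z * d) c (fun v => s v + (v == x)%:Z * j) set0.
Proof.
move=> val slack xW rootx parx ledj rootW cutx; split.
- exact: valid_ends val.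
- by move=> v /(valid_root_edges val); case: eqP => [->|]; lia.
- exact: valid_parity_c val.
- by move=> v /(valid_parity_b val); case: eqP => [->|]; lia.
- exact: valid_sum val.
- by left.
- by rewrite !weight_upd xW !mul1r.
move=> A sAW A0 AW _; rewrite !weight_upd.
have [A1|[v defA]] := card_gt1_or_set1 A0.
  have := slack A sAW A1 AW; have := dist_mulD k_gt0 (weight b A) d.
  by case: (x \in A); rewrite ?mul1r ?mul0r ?addr0; lia.
have := valid_cut val sAW A0 AW A0; rewrite defA !weight1 inE.
by case: eqP => [<-|_]; rewrite ?mul1r ?mul0r ?addr0.
Qed.

(** If some vertex accepts an incoming edge, an edge from a neighbour is directed into it. Otherwise
    the root edges at one vertex are modified, either to reduce their number or to make that vertex
    accept an incoming edge. *)
Lemma solvable_accepts1 g E W b c s : valid g E W b c s set0 ->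
    solvable_below (#|W| + #|E|) -> (1 < #|W|)%N ->
    (forall b' s', valid g E W b' c s' set0 -> weight s' W < weight s W -> solvable g E W c) ->
    (forall v, v \in W -> accepts g E b s v 1) ->
  solvable g E W c.
Proof.
move=> val IH W1 IHs acc1.
have [//|slack] := solvable_tight_or_slack val IH.
have [/exists_inP[v vW accv]|none] := boolP [exists v in W, accepts g E b s v (-1)].
  have [e [y [eE evy yW yv]]] := valid_neighbour val W1 vW.
  exact: solvable_edge val IH eE (has_ends_sym evy) yv (acc1 _ yW) accv.
have prop1 v : v \in W -> [set v] != set0 /\ [set v] != W.
  move=> vW; split; first by apply/set0Pn; exists v; rewrite inE.
  by apply: contraTneq W1 => <-; rewrite cards1.
(* No vertex accepts an incoming edge, so every single vertex is tight with residue strictly between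
   0 and [k]. *)
have residue v : v \in W -> exists r q, [/\ b v = r + K * q, 0 < r, r < k%:Z, dist (b v) = r &
    cut g E [set v] + s v = K - 2 + r].
  move=> vW; have := acc1 v vW; have : ~~ accepts g E b s v (-1).
    by apply: contra none => accv; apply/exists_inP; exists v.
  rewrite /accepts opprK negb_or => /andP[tight /eqP up]; rewrite (negPf tight) /= => /eqP down.
  have [r [q [bE r_gt0 ltrk dE]]] := dist_mul_down k_gt0 down up.
  exists r, q; split=> //; have [v0 vW'] := prop1 v vW.
  have := valid_cut val _ v0 vW' v0; rewrite sub1set vW !weight1 => /(_ isT).
  by have := valid_parity_b val vW; have := dist_mul_parity k_gt0 (b v); lia.
have via_edge b' s' v : v \in W -> valid g E W b' c s' set0 ->
    (forall y, y != v -> b' y = b y /\ s' y = s y) -> accepts g E b' s' v (-1) ->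
    solvable g E W c.
  move=> vW val' same accv.
  have [e [y [eE evy yW yv]]] := valid_neighbour val W1 vW.
  apply: (solvable_edge val' IH eE (has_ends_sym evy) yv _ accv).
  by have := acc1 y yW; rewrite /accepts; have [-> ->] := same y yv.
(* Here some root edge at [x] is outgoing. Dropping it lowers the residue and the degree of [x] by
   one each, and reduces the total number of root edges. *)
have [/exists_inP[x xW ltx]|allin] := boolP [exists x in W, - s x < b x - c x].
  have [r [q [bx r_gt0 ltrk dx tx]]] := residue x xW.
  have := valid_parity_b val xW; have := valid_parity_c val xW.
  have := valid_root_edges val xW => root_x par_c par_b.
  have val' : valid g E W (fun v => b v + (v == x)%:Z * -1) c
                          (fun v => s v + (v == x)%:Z * -1) set0.
    apply: valid_update_root => //; try by lia.
      by have := valid_root val; have := dist_mulD k_gt0 (weight b W - 1) 1; rewrite subrK; lia.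
    have -> : dist (b x - 1) = r - 1 by rewrite bx addrAC dist_mul_small //; lia.
    by lia.
  by apply: IHs val' _; rewrite weight_upd xW; lia.
(* From here on all root edges are incoming. *)
have bs v : v \in W -> b v = c v - s v.
  move=> vW; have : ~~ (- s v < b v - c v).
    by apply: contra allin => ltv; apply/exists_inP; exists v.
  by have := valid_root_edges val vW; lia.
have distW d : dist (weight b W + d) = dist (d - weight s W).
  apply: (dist_mul_mod k_gt0); rewrite (eq_weight bs) -weightB.
  by have := valid_sum val; congr (dvdz _ _); lia.
have sW_ge0 := weight_root_ge0 val (subxx W).
have [sW0|sW_neq0] := eqVneq (weight s W) 0.
  have /card_gt0P[x xW] : (0 < #|W|)%N by exact: ltnW.
  have [r [q [bx r_gt0 ltrk dx tx]]] := residue x xW.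
  have dx' : dist (b x - 1) = r - 1 by rewrite bx addrAC dist_mul_small //; lia.
  have := valid_root_edges val xW => root_x; have := bs x xW => bsx.
  (* An incoming root edge is added at [x]: the residue falls and the degree rises, which gives [x]
     slack 2. *)
  apply: (via_edge (fun v => b v + (v == x)%:Z * -1) (fun v => s v + (v == x)%:Z * 1) x) => //.
  - apply: valid_update_root => //; try by lia.
    rewrite distW sW0 subr0 -[-1]addr0 -(mulr0 K) dist_mul_small //; lia.
  - by move=> y /negPf->; rewrite !mul0r !addr0.
  by rewrite /accepts eqxx !mul1r dx'; lia.
have [x xW sx_gt0] : exists2 x, x \in W & 0 < s x.
  apply/exists_inP; apply: contraNT sW_neq0; rewrite negb_exists_in => /forall_inP s_le0.
  rewrite /weight big1 // => v vW; have := s_le0 v vW; have := valid_root_edges val vW.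
  by lia.
have [r [q [bx r_gt0 ltrk dx tx]]] := residue x xW.
(* One incoming root edge at [x] is replaced with [k - r] outgoing ones: this keeps
   [c], and turns the residue [r] of [x] into [k + 1], that is, [-(k - 1)]. *)
pose m := k%:Z - r.
have := valid_root_edges val xW => root_x; have := bs x xW => bsx.
have bx' : b x + (m + 1) = (1 - k%:Z) + K * (q + 1) by rewrite bx /m; lia.
have dx' : dist (b x + (m + 1)) = k%:Z - 1 by rewrite bx' dist_mul_small //; lia.
apply: (via_edge (fun v => b v + (v == x)%:Z * (m + 1))
                 (fun v => s v + (v == x)%:Z * (m - 1)) x) => //.
- apply: valid_update_root => //; try by rewrite /m; lia.
    rewrite distW; have := valid_root val; rewrite -[weight b W]addr0 distW sub0r dist_mulN //.
    move: (weight s W) sW_ge0 sW_neq0 => D D_ge0 D_neq0 leD.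
    (* The root bound itself forces fewer than [2k] root edges. *)
    have leDk : D < K.
      have [a [p [DE le_a dE]]] := dist_mulE k_gt0 D; rewrite dE in leD.
      rewrite ltNge; apply/negP => geDk; have p_gt0 : 0 < p.
        by rewrite ltNge; apply/negP => p_le0; have : K * p <= 0; [rewrite pmulr_rle0; lia | lia].
      have [p1|p2] : p = 1 \/ 2 <= p by lia.
        by rewrite p1 in DE; lia.
      by have : K * 2 <= K * p; [rewrite ler_pM2l; lia | lia].
    (* If the distance is attained without a shift, the new root bound follows from [m < k]; after a
       shift by one period it follows from [D < 2k]. *)
    have [le_mD|lt_mD] := lerP (D - (m + 1)) k%:Z.
      by rewrite -[_ - D]addr0 -(mulr0 K) dist_mul_small //; lia.
    have -> : m + 1 - D = (m + 1 - D + K) + K * -1 by lia.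
    by rewrite dist_mul_small //; lia.
  by rewrite dx'; rewrite /m; lia.
- by move=> y /negPf->; rewrite !mul0r !addr0.
rewrite /accepts eqxx !mul1r dx' opprK bx'; apply/orP; right.
by rewrite addrAC dist_mul_small //; lia.
Qed.

(** Reversing all edges negates the targets; this exchanges the acceptance of outgoing and of
    incoming edges. *)
Lemma valid_opp g E W b c b' c' s X :
    (forall v, b' v = - b v) -> (forall v, c' v = - c v) ->
  valid g E W b c s X -> valid g E W b' c' s X.
Proof.
move=> b'E c'E val.
have wN (d d' : V -> int) A : (forall v, d' v = - d v) -> weight d' A = - weight d A.
  by move=> d'E; rewrite /weight -sumrN; apply: eq_bigr.
split.
- exact: valid_ends val.
- by move=> v /(valid_root_edges val); rewrite b'E c'E; lia.
- by move=> v /(valid_parity_c val); rewrite c'E; lia.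
- by move=> v /(valid_parity_b val); rewrite b'E; lia.
- by rewrite (wN _ _ _ c'E) rpredN; apply: valid_sum val.
- by case: (valid_exempt val) => [|[x [-> xW bx]]]; [left | right; exists x; rewrite b'E rpredN].
- by rewrite (wN _ _ _ b'E) dist_mulN //; apply: valid_root val.
- by move=> A sAW A0 AW AX; rewrite (wN _ _ _ b'E) dist_mulN //; apply: (valid_cut val).
Qed.

Lemma solvable_opp g E W c c' : (forall v, c' v = - c v) ->
  solvable g E W c' -> solvable g E W c.
Proof.
move=> c'E [o so oc]; exists (fun e => - o e); first by move=> e; case: (so e) => ->; auto.
move=> v /oc; have -> : net g (fun e => - o e) E [set v] = - net g o E [set v].
  by rewrite /net -sumrN; apply: eq_bigr => e _; rewrite mulNr.
by rewrite c'E -opprD rpredN opprK.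
Qed.

Lemma accepts_opp g E b s v h :
  accepts g E (fun v => - b v) s v h = accepts g E b s v (- h).
Proof. by rewrite /accepts !dist_mulN // -opprD dist_mulN // opprK. Qed.

(** The outer induction is on the number of vertices and edges, the inner one on the number of root
    edges of a fixed graph. *)
Theorem solvable_valid g E W b c s X : valid g E W b c s X -> solvable g E W c.
Proof.
have [n] := ubnP (#|W| + #|E|); elim: n g E W b c s X => // n IHn g E W b c s X ltn val.
have IH : solvable_below (#|W| + #|E|).
  by move=> g' E' W' b' c' s' X' val' lt'; apply: IHn val'; apply: leq_trans lt' _.
have exempt x b' s' : valid g E W b' c s' [set x] -> solvable g E W c.
  by move=> val'; apply: solvable_exempt val' IH.
have [X0|[x [Xx _ _]]] := valid_exempt val; last by rewrite Xx in val; apply: exempt val.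
rewrite {X}X0 in val.
have [W1|W1] := leqP #|W| 1; first exact: solvable_small (valid_ends val) (valid_sum val) W1.
have [m] := ubnP `|weight s W|%N; elim: m b s val => // m IHm b s val ltm.
have IHs b' s' : valid g E W b' c s' set0 -> weight s' W < weight s W -> solvable g E W c.
  move=> val' lts; apply: (IHm b' s') => //.
  by have := weight_root_ge0 val' (subxx W); lia.
(* A vertex of residue 0 can be declared exempt, which only weakens the cut condition. *)
have [/exists_inP[x xW bx]|nozero] := boolP [exists x in W, (K %| b x)%Z].
  apply: (exempt x b s); split; try by case: val.
    by right; exists x.
  by move=> A sAW A0 AW _; apply: (valid_cut val).
have acc v : v \in W -> accepts g E b s v 1 || accepts g E b s v (-1).
  move=> vW; have : ~~ (K %| b v)%Z.
    by apply: contra nozero => bv; apply/exists_inP; exists v.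
  by rewrite /accepts => /(dist_mul_step k_gt0)[e [] ->] ->; rewrite eqxx ?orbT.
pose P := [set v in W | accepts g E b s v 1].
have sPW : P \subset W by apply/subsetP => v; rewrite inE => /andP[].
have [PW|PW] := eqVneq P W.
  by apply: solvable_accepts1 val IH W1 IHs _ => v; rewrite -PW inE => /andP[].
have [P0|P0] := eqVneq P set0.
  have opp (d : V -> int) v : - d v = - d v by [].
  apply: (solvable_opp (opp c)); have valN := valid_opp (opp b) (opp c) val.
  apply: (solvable_accepts1 valN) => //.
    move=> b' s' val' lts.
    apply: (solvable_opp (c := fun v => - c v)) (IHs (fun v => - b' v) s' _ lts).
      by move=> v; rewrite opprK.
    by apply: valid_opp val' => v; rewrite ?opprK.
  move=> v vW; rewrite accepts_opp; have := acc v vW.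
  by move/setP/(_ v): P0; rewrite !inE vW /= => ->.
(* Some edge leaves [P], and it is directed out of [P]: its end outside must accept an incoming
   edge. *)
have [e eE de] := cut_gt0 (valid_cut_gt0 val sPW P0 PW).
have [x [y [exy xP yP]]] := crossing_ends de.
have [xW yW] := has_ends_in (valid_ends val) eE exy.
move: xP yP; rewrite !inE xW yW /= => accx accy.
apply: (solvable_edge val IH eE exy) => //.
  by apply: contraNneq accy => <-.
by have := acc y yW; rewrite (negPf accy).
Qed.

(** * Packings of spanning subgraphs *)

(** Spanning connected subgraphs, expressed through cuts because contraction and splitting off act
    on these directly. *)
Definition spans g (F : {set ET}) W : bool :=
  [forall A : {set V}, [&& A \subset W, A != set0 & A != W] ==>
     [exists e in F, delta g e A != 0]].

Lemma spansP g (F : {set ET}) W :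
  reflect (forall A, A \subset W -> A != set0 -> A != W -> exists2 e, e \in F & delta g e A != 0)
          (spans g F W).
Proof.
apply: (iffP forallP) => [sp A sAW A0 AW | sp A].
  by have := sp A; rewrite sAW A0 AW => /exists_inP.
by apply/implyP => /and3P[sAW A0 AW]; apply/exists_inP; apply: sp.
Qed.

Lemma spans_contract phi g E (F : {set ET}) W : ends_in g E W -> F \subset E ->
  spans g F W -> spans (contract phi g) F (phi @: W).
Proof.
move=> gW /subsetP sFE /spansP sp; apply/spansP => B sB B0 BW.
have [|||e eF de] := sp (fiber phi W B).
- exact: fiber_sub.
- by rewrite fiber_eq0.
- by rewrite fiber_eq_full.
by exists e; rewrite // (delta_contract phi B gW (sFE _ eF)).
Qed.

(** The edge [e] is a bridge of [F], and [A] is the side of it away from [v]. *)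
Lemma spans_essential g E (F : {set ET}) W e v x : ends_in g E W -> F \subset E -> e \in F ->
    spans g F W -> ~~ spans g (F :\ e) W -> has_ends g e v x ->
  exists A, [/\ A \subset W, v \notin A, x \in A &
    forall h, h \in F -> delta g h A != 0 -> h = e].
Proof.
move=> gW sFE eF /spansP sp; rewrite negb_forall => /existsP[A].
rewrite negb_imply => /andP[/and3P[sAW A0 AW] nocross] evx.
have eE := subsetP sFE _ eF; have [vW xW] := has_ends_in gW eE evx.
have uniq h : h \in F -> delta g h A != 0 -> h = e.
  move=> hF dh; apply/eqP; apply: contraNT nocross => he; apply/exists_inP.
  by exists h; rewrite // !inE he.
have [h hF dh] := sp A sAW A0 AW; have he := uniq h hF dh; rewrite {}he in dh.
move: dh; rewrite -normr_eq0 (delta_ends _ evx).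
have [vA|vA] := boolP (v \in A) => dE; last first.
  by exists A; split=> //; case: (x \in A) dE.
exists (W :\: A); split.
- exact: subsetDl.
- by rewrite inE vA.
- by rewrite inE xW andbT; case: (x \in A) dE.
move=> h' h'F; have [uW wW] := gW _ (subsetP sFE _ h'F).
move=> dh'; apply: uniq => //; move: dh'.
by rewrite /delta !inE uW wW; case: (_ \in A); case: (_ \in A).
Qed.

Section Packings.
Variable I : finType.
Implicit Types (T : I -> {set ET}) (i j l : I) (J : {set I}).

Definition disjoint_in T E : Prop :=
  (forall i, T i \subset E) /\ (forall i j, i != j -> [disjoint T i & T j]).

Lemma disjoint_in_inj T E e i j : disjoint_in T E -> e \in T i -> e \in T j -> i = j.
Proof.
move=> [_ dT] ei ej; apply/eqP/negPn/negP => /dT /pred0P/(_ e) /=.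
by rewrite ei ej.
Qed.

Lemma disjoint_in_sub T T' E E' : disjoint_in T E -> (forall i, T' i \subset T i) ->
  (forall i, T' i \subset E') -> disjoint_in T' E'.
Proof.
move=> [_ dT] sT sE; split=> // i j ij.
exact: disjointWl (sT i) (disjointWr (sT j) (dT i j ij)).
Qed.

Lemma sum_card_disjoint T E (F : {set ET}) J : disjoint_in T E ->
  (\sum_(i in J) #|[set e in T i | e \in F]| <= #|F|)%N.
Proof.
move=> dT.
have -> : (\sum_(i in J) #|[set e in T i | e \in F]| = \sum_(e in F) \sum_(i in J) (e \in T i))%N.
  rewrite exchange_big; apply: eq_bigr => i _; rewrite -sum1_card big_mkcond [RHS]big_mkcond.
  by apply: eq_bigr => e _; rewrite inE; case: (e \in F); case: (e \in T i).
rewrite -sum1_card; apply: leq_sum => e _.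
have [/existsP[i ei]|none] := boolP [exists i, e \in T i]; last first.
  rewrite big1 // => i _; case ei: (e \in T i) => //.
  by case/negP: none; apply/existsP; exists i.
have others j : (e \in T j : nat) = (j == i).
  case ej: (e \in T j); first by rewrite (disjoint_in_inj dT ej ei) eqxx.
  by case: eqP => // ji; rewrite ji ei in ej.
rewrite (eq_bigr (fun j => (j == i) : nat)) // big_mkcond /= (bigD1 i) //= eqxx.
by rewrite big1 ?addn0; [case: ifP | move=> j /negPf->; case: ifP].
Qed.

Definition packing_below n := forall g E W c T,
  ends_in g E W -> (forall v, v \in W -> (2 %| cut g E [set v] - c v)%Z) ->
  (K %| weight c W)%Z -> disjoint_in T E -> (forall i, spans g (T i) W) ->
  (#|W| < n)%N -> solvable g E W c.

(** The nonloop edges at [v] are oriented to meet its target, and the other targets are corrected.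
    With [k - 1] edges every residue of the right parity is reachable: [k] itself would have the
    wrong parity. *)
Lemma solvable_delete_vertex g E W c T v :
    packing_below #|W| -> ends_in g E W ->
    (forall v, v \in W -> (2 %| cut g E [set v] - c v)%Z) ->
    (K %| weight c W)%Z -> disjoint_in T E -> v \in W ->
    (forall i, spans g [set e in T i | delta g e [set v] == 0] (W :\ v)) ->
    k%:Z - 1 <= cut g E [set v] ->
  solvable g E W c.
Proof.
move=> IH gW parc cW dT vW sp cutv.
pose F := [set e in E | delta g e [set v] != 0].
have sFE : F \subset E by apply/subsetP => e; rewrite inE => /andP[].
have dnF e : e \in E :\: F -> delta g e [set v] = 0.
  by rewrite !inE => /andP[eF eE]; move: eF; rewrite eE negbK => /eqP.
have [a [q [cE le_a _]]] := dist_mulE k_gt0 (c v).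
have parv := parc v vW; rewrite cE in parv.
have [|||o1 [so1 net1 _]] := @reorient_at _ _ g (fun=> 1) E v a.
- by left.
- by move: parv cutv le_a (k_gt1); clear; lia.
- by move: parv; clear; lia.
pose E1 := [set e in E | ((g e).1 != v) && ((g e).2 != v)].
have sE1 : E1 \subset E :\: F.
  apply/subsetP => e; rewrite !inE /delta !inE => /and3P[eE /negPf-> /negPf->].
  by rewrite eE.
(* The edges outside both [F] and [E1] are loops at [v]. *)
have offv e u : e \in (E :\: F) :\: E1 -> u != v -> delta g e [set u] = 0.
  move=> eEFE1 uv; have := dnF e; have: e \in E :\: F by case/setDP: eEFE1.
  move=> eEF /(_ eEF); case/setDP: eEFE1 => _; case/setDP: eEF => eE _.
  rewrite !inE eE /= negb_and !negbK /delta !inE.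
  case: (g e) => p r /=; have [->|pv] := eqVneq p v; have [->|rv] := eqVneq r v => //= _ _.
  by rewrite eq_sym (negPf uv).
pose c1 u := c u - net g o1 F [set u].
have cut1 u : u != v -> cut g E [set u] = cut g F [set u] + cut g E1 [set u].
  move=> uv; rewrite (cut_split _ _ sFE) (cut_split _ _ sE1) [cut _ (_ :\: E1) _]big1 ?addr0 //.
  by move=> e /offv->; rewrite ?normr0.
have [||||||o so oc] := IH g E1 (W :\ v) c1 (fun i => T i :&: E1).
- move=> e; rewrite !inE => /and3P[eE pv rv]; have [pW rW] := gW e eE.
  by rewrite pv pW rv rW.
- move=> u; rewrite !inE => /andP[uv uW]; have := parc u uW; rewrite /c1 cut1 //.
  by have := parity_net g F [set u] so1; clear; lia.
- have gF : ends_in g F W by move=> e /(subsetP sFE); apply: gW.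
  have svW : [set v] \subset W by rewrite sub1set.
  have netF : net g o1 F [set v] = a.
    rewrite -net1 (net_split _ _ _ sFE) [net g o1 (_ :\: _) _]big1 ?addr0 //.
    by move=> e /dnF->; rewrite mulr0.
  rewrite /c1 -weightB -net_weight (net_compl _ _ gF) netF.
  have -> : weight c (W :\ v) - - a = weight c W - K * q.
    by rewrite (weight_setD _ svW) weight1; lia.
  by apply: rpredB => //; apply: dvdz_mulr.
- apply: (disjoint_in_sub dT) => i; [exact: subsetIl | exact: subsetIr].
- move=> i; apply/spansP => A sA A0 AW; have /spansP/(_ A sA A0 AW)[e] := sp i.
  rewrite inE => /andP[eT /eqP dev] deA; exists e => //; rewrite inE eT inE.
  have vA : v \notin A by apply/negP => /(subsetP sA); rewrite !inE eqxx.
  rewrite (subsetP (dT.1 i)) //=; move: dev deA; rewrite /delta !inE.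
  case: (g e) => p r /=; have [->|pv] := eqVneq p v; have [->|rv] := eqVneq r v => //=.
  by rewrite (negPf vA).
- by rewrite [in X in (_ < X)%N](cardsD1 v) vW.
pose o2 e := if e \in F then o1 e else o e.
have o2E B : net g o2 E B = net g o1 F B + net g o (E :\: F) B.
  rewrite (net_split _ _ _ sFE); congr (_ + _); apply: eq_bigr => e; rewrite /o2.
    by move=> ->.
  by rewrite inE => /andP[/negPf->].
exists o2; first by move=> e; rewrite /o2; case: ifP.
move=> u uW; have [->|uv] := eqVneq u v.
  have -> : net g o2 E [set v] = a.
    rewrite -net1; apply: eq_net_ends => e eE; rewrite /o2 inE eE /=.
    by case: eqP => //= ->; rewrite !mulr0.
  by rewrite cE opprD addrA subrr sub0r rpredN dvdz_mulr.
have := oc u; rewrite !inE uv uW => /(_ isT); rewrite /c1 o2E (net_split _ _ _ sE1).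
rewrite [net g o (_ :\: E1) _]big1 => [|e /offv->]; rewrite ?mulr0 //.
by congr (dvdz _ _); clear; lia.
Qed.

(* While some [T i] with [i \in J] has two edges at [v], one of them is split off
   together with the only edge at [v] of another [T j], which is then used up. *)
Lemma solvable_split_vertex g E W c T J v (r : int) :
    packing_below #|W| -> (1 < #|W|)%N -> ends_in g E W ->
    (forall v, v \in W -> (2 %| cut g E [set v] - c v)%Z) ->
    (K %| weight c W)%Z -> disjoint_in T E -> v \in W ->
    {in J, forall i, spans g (T i) W} ->
    (forall i, i \notin J -> spans g (T i) (W :\ v) /\
       forall e, e \in T i -> delta g e [set v] = 0) ->
    cut g E [set v] + r = 2 * #|J|%:Z -> k%:Z - 1 <= r ->
  solvable g E W c.
Proof.
move=> IH W1; have [n] := ubnP (#|E| + \sum_i #|T i|).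
elim: n g E T J => // n IHn g E T J ltn gW parc cW dT vW spJ spN cutJ ler.
have v0 : [set v] != set0 by apply/set0Pn; exists v; rewrite inE.
have vW' : [set v] != W by apply: contraTneq W1 => <-; rewrite cards1.
have svW : [set v] \subset W by rewrite sub1set.
pose F := [set e in E | delta g e [set v] != 0].
pose D i := [set e in T i | e \in F].
have sTE i : T i \subset E := dT.1 i.
have DE i e : (e \in D i) = (e \in T i) && (delta g e [set v] != 0).
  by rewrite !inE; case eT: (e \in T i) => //=; rewrite (subsetP (sTE i)).
have cutF : #|F|%:Z = cut g E [set v] by rewrite cut_card.
have sumD : (\sum_(i in J) #|D i| <= #|F|)%N by exact: sum_card_disjoint dT.
have D_gt0 i : i \in J -> (0 < #|D i|)%N.
  move=> iJ; have /spansP/(_ _ svW v0 vW')[e eT de] := spJ i iJ.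
  by apply/card_gt0P; exists e; rewrite DE eT.
have sumJ (m : nat) : (\sum_(i in J) m = m * #|J|)%N by rewrite sum_nat_const mulnC.
have [/exists_inP[i iJ Di]|small] := boolP [exists i in J, 1 < #|D i|]%N; last first.
  have D1 i e f : i \in J -> e \in D i -> f \in D i -> e = f.
    move=> iJ eD fD; apply/eqP; apply: contraNT small => ef; apply/exists_inP; exists i => //.
    by apply/card_gt1P; exists e, f.
  apply: (solvable_delete_vertex IH gW parc cW dT vW).
    move=> i; have [iJ|iJ] := boolP (i \in J); last first.
      have [sp off] := spN i iJ; suff <- : T i = [set e in T i | delta g e [set v] == 0] by [].
      by apply/setP => e; rewrite inE; case eT: (e \in T i) => //=; rewrite off ?eqxx.
    apply/spansP => A sA A0 AW.
    have vA : v \notin A by apply/negP => /(subsetP sA); rewrite !inE eqxx.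
    have sAW : A \subset W by apply: subset_trans sA (subD1set _ _).
    have AW' : A != W by apply: contraNneq vA => ->.
    have /spansP sp := spJ i iJ; have [h hT dh] := sp A sAW A0 AW'.
    have [hv|hv] := eqVneq (delta g h [set v]) 0; first by exists h; rewrite // inE hT hv eqxx.
    (* The edge [h] joins [v] to [A], so it does not cross [A] with [v] added. Some other edge does,
       and it avoids [v] because [h] is the only edge of [T i] there. *)
    have [||| h' h'T dh'] := sp (v |: A).
    - by rewrite subUset svW.
    - by apply/set0Pn; exists v; rewrite !inE eqxx.
    - by apply: contraNneq AW => <-; rewrite setU1K.
    have dU e : delta g e (v |: A) = delta g e [set v] + delta g e A.
      rewrite /delta !inE; case: (g e) => p q /=.
      have [->|_] := eqVneq p v; have [->|_] := eqVneq q v; rewrite ?(negPf vA) /=;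
      by case: (p \in A); case: (q \in A).
    have [h'v|h'v] := eqVneq (delta g h' [set v]) 0.
      by exists h'; rewrite ?inE ?h'T ?h'v //; move: dh'; rewrite dU h'v add0r.
    have hh' : h' = h by apply: (D1 i); rewrite // DE ?h'T ?hT.
    move: dh' dh hv; rewrite hh' /delta !inE; case: (g h) => p q /=.
    have [->|_] := eqVneq p v; have [->|_] := eqVneq q v; rewrite ?(negPf vA) //=.
      by case: (q \in A).
    by case: (p \in A).
  (* Each [T i] with [i] in [J] has an edge at [v], so the degree is at least the size of [J] and
     hence at least [r]. *)
  have : (\sum_(i in J) 1 <= \sum_(i in J) #|D i|)%N by apply: leq_sum => i /D_gt0.
  by rewrite sumJ -cutF; lia.
(* If every [T j] had two edges at [v], the degree would reach twice the size of [J], contrary to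
   [r > 0]. *)
have [j jJ /eqP Dj] : exists2 j, j \in J & #|D j| == 1%N.
  apply/exists_inP; apply: contraT => /exists_inPn none.
  have : (\sum_(i in J) 2 <= \sum_(i in J) #|D i|)%N.
    apply: leq_sum => l lJ; have := none l lJ; have := D_gt0 l lJ.
    by rewrite -cutF in cutJ; case: #|D l| => [|[]].
  by rewrite sumJ; lia.
have ij : i != j by apply: contraTneq Di => ->; rewrite Dj.
have [f Df] : exists f, D j = [set f] by apply/cards1P; rewrite Dj.
have [fT dfv] : f \in T j /\ delta g f [set v] != 0.
  by apply/andP; rewrite -DE Df inE.
have fE := subsetP (sTE j) _ fT; have [y fvy yv] := incident_ends dfv.
(* An edge that [T i] can spare is discarded from it; the induction measure counts the sets [T l] as
   well as [E]. *)
have drop e : e \in D i -> spans g (T i :\ e) W -> solvable g E W c.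
  rewrite DE => /andP[eT dev] sp.
  pose T' l := if l == i then T i :\ e else T l.
  have sT' l : T' l \subset T l by rewrite /T'; case: eqP => [->|] //; rewrite subD1set.
  apply: (IHn g E T' J) => //.
  - apply: (@leq_trans (#|E| + \sum_i #|T i|)); last by rewrite -ltnS.
    rewrite ltn_add2l.
    rewrite (bigD1 i) //= [in X in (_ < X)%N](bigD1 i) //= {1}/T' eqxx.
    rewrite [in X in (_ < X)%N](cardsD1 e) eT add1n addSn ltnS leq_add2l.
    by apply: leq_sum => l _; apply: subset_leq_card.
  - by apply: (disjoint_in_sub dT) => // l; apply: subset_trans (sTE l).
  - by move=> l lJ; rewrite /T'; case: eqP => // _; apply: spJ.
  - move=> l lJ; rewrite /T'; case: eqP => [li|_]; last exact: spN.
    by rewrite li iJ in lJ.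
(* Splitting off the bridge [e] with [f] keeps [T i] spanning when [y] is not on the far side [A] of
   [e]. *)
have step e x A : e \in T i -> delta g e [set v] != 0 -> has_ends g e v x -> x != v ->
    A \subset W -> v \notin A -> x \in A ->
    (forall h, h \in T i -> delta g h A != 0 -> h = e) -> y \notin A -> solvable g E W c.
  move=> eT dev evx xv sAW vA xA uniq yA; have eE := subsetP (sTE i) _ eT.
  have ef : e != f.
    by apply: contraNneq ij => ef; apply/eqP; apply: (disjoint_in_inj dT eT); rewrite ef.
  have dsame l h B : h \in T l -> l != i -> delta (split_off g e x y) h B = delta g h B.
    move=> hT li; apply: delta_split_off; apply: contraNneq li => he.
    by apply/eqP; apply: (disjoint_in_inj dT hT); rewrite he.
  have fT' l h : h \in T l -> l != j -> h \in T l :\ f.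
    move=> hT lj; rewrite !inE hT andbT; apply: contraNneq lj => hf.
    by apply/eqP; apply: (disjoint_in_inj dT hT); rewrite hf.
  have [||||||||||o' so' o'c] := IHn (split_off g e x y) (E :\ f) (fun l => T l :\ f) (J :\ j).
  - apply: (@leq_trans (#|E| + \sum_i #|T i|)); last by rewrite -ltnS.
    rewrite [in X in (_ < X)%N](cardsD1 f) fE add1n addSn ltnS.
    by rewrite leq_add2l; apply: leq_sum => l _; rewrite subset_leq_card ?subD1set.
  - exact: (ends_in_split_off eE fE evx fvy gW).
  - move=> u /parc; have := cut_split_off_parity eE fE ef evx fvy [set u].
    by clear; lia.
  - exact: cW.
  - by apply: (disjoint_in_sub dT) => l; [exact: subD1set | exact: setSD].
  - exact: vW.
  - move=> l; rewrite !inE => /andP[lj lJ]; apply/spansP => B sBW B0 BW.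
    have [li|li] := eqVneq l i; last first.
      have /spansP/(_ B sBW B0 BW)[h hT dh] := spJ l lJ.
      by exists h; rewrite ?(dsame l) // fT'.
    rewrite {l}li in lj lJ *; have /spansP sp := spJ i iJ.
    have [h hT dh] := sp B sBW B0 BW.
    have [he|he] := eqVneq h e; last by exists h; rewrite ?delta_split_off // fT'.
    have [/exists_inP[h' h'T /andP[h'e dh']]|only] :=
      boolP [exists h' in T i, (h' != e) && (delta g h' B != 0)].
      by exists h'; rewrite ?delta_split_off // fT'.
    exists e; first exact: fT'.
    rewrite delta_split_off_eq; apply: contraNneq only => xyB.
    rewrite {}he in dh.
    have [xW yW] : x \in W /\ y \in W.
      by split; [case: (has_ends_in gW eE evx) | case: (has_ends_in gW fE fvy)].
    (* [B'] is the side of [B] that avoids [v]; it contains [x] and [y], so some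
       edge other than [e] crosses [B' :\: A]. *)
    pose B' := if v \in B then W :\: B else B.
    have dB' h' : h' \in T i -> (delta g h' B' == 0) = (delta g h' B == 0).
      rewrite /B' => h'T; case: ifP => // _; have [pW qW] := gW _ (subsetP (sTE i) _ h'T).
      by rewrite /delta !inE pW qW !andbT; case: (_ \in B); case: (_ \in B).
    have sB'W : B' \subset W by rewrite /B'; case: ifP; rewrite ?subsetDl.
    have vB' : v \notin B' by rewrite /B'; case: ifP; rewrite ?inE => ->.
    have [xB' yB'] : x \in B' /\ y \in B'.
      have := dh; rewrite -dB' // -normr_eq0 (delta_ends _ evx) (negPf vB').
      rewrite /B'; case: ifP => _; rewrite ?inE ?xW ?yW ?andbT; move: xyB;
      by case: (x \in B); case: (y \in B).
    have [|||h' h'T dh'] := sp (B' :\: A).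
    - by apply: subset_trans sB'W; apply: subsetDl.
    - by apply/set0Pn; exists y; rewrite inE yA.
    - by apply: contraTneq vW => <-; rewrite inE (negPf vB') andbF.
    have h'e : h' != e.
      apply: contraNneq dh' => ->; rewrite -normr_eq0 (delta_ends _ evx) !inE.
      by rewrite (negPf vB') xA andbF.
    apply/exists_inP; exists h'; rewrite // h'e -dB' //=.
    have : delta g h' A == 0 by apply/negPn/negP => /(uniq _ h'T); apply/eqP.
    apply: contraTneq => dB0; apply: contraNneq dh'; move: dB0; rewrite /delta !inE.
    by case: (_ \in A); case: (_ \in A); case: (_ \in B'); case: (_ \in B').
  - move=> l; rewrite !inE negb_and negbK => lJ.
    have li : l != i.
      by apply: contraTneq lJ => ->; rewrite (negPf ij) iJ.
    have [lj|lj] := eqVneq l j; last first.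
      rewrite (negPf lj) /= in lJ; have [sp off] := spN l lJ; split.
        apply/spansP => B sB B0 BW; have /spansP/(_ B sB B0 BW)[h hT dh] := sp.
        by exists h; rewrite ?(dsame l) // fT'.
      by move=> h; rewrite inE => /andP[_ hT]; rewrite (dsame l) // off.
    rewrite {l lJ}lj in li *.
    have offv h : h \in T j -> h != f -> delta g h [set v] = 0.
      move=> hT hf; apply/eqP/negPn/negP => dhv; case/negP: hf.
      by rewrite -in_set1 -Df DE hT.
    split; last by move=> h; rewrite !inE => /andP[hf hT]; rewrite (dsame j) // offv.
    (* [f] is the only edge of [T j] at [v], so any cut avoiding [v] that only [f]
       crosses would turn into an uncrossed cut once [v] is added. *)
    apply/spansP => B sB B0 BW.
    have vB : v \notin B by apply/negP => /(subsetP sB); rewrite !inE eqxx.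
    have /spansP sp := spJ j jJ.
    have [| | |h hT dh] := sp B.
    - by apply: subset_trans sB (subD1set _ _).
    - by [].
    - by apply: contraNneq vB => ->.
    have [hf|hf] := eqVneq h f; last by exists h; rewrite ?(dsame j) // !inE hf.
    have [|||h' h'T dh'] := sp (v |: B).
    - by rewrite subUset svW (subset_trans sB (subD1set _ _)).
    - by apply/set0Pn; exists v; rewrite !inE eqxx.
    - by apply: contraNneq BW => <-; rewrite setU1K.
    have yB : y \in B.
      move: dh; rewrite hf -normr_eq0 (delta_ends _ fvy) (negPf vB).
      by case: (y \in B).
    have h'f : h' != f.
      apply: contraNneq dh' => ->; rewrite -normr_eq0 (delta_ends _ fvy).
      by rewrite !inE eqxx yB orbT.
    exists h'; first by rewrite !inE h'f.
    rewrite (dsame j) //; apply: contraNneq dh' => dB0; move: dB0 (offv h' h'T h'f).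
    rewrite /delta !inE; case: (g h') => p q /=.
    have [->|_] := eqVneq p v; have [->|_] := eqVneq q v; rewrite ?(negPf vB) //=.
    by move=> ->.
  (* The degree of [v] falls by two and [J] loses one index, so [r] is invariant. *)
  - move: cutJ; rewrite (cardsD1 j) jJ (cut_split_off_center eE fE ef evx fvy xv yv).
    by clear; lia.
  - exact: ler.
  have [o so oE] := signing_split_off eE fE ef evx fvy so'.
  by exists o => // u /o'c; rewrite oE.
have /card_gt1P[e1 [e2 [e1D e2D e12]]] := Di.
have [sp1|ess1] := boolP (spans g (T i :\ e1) W); first exact: drop sp1.
have [sp2|ess2] := boolP (spans g (T i :\ e2) W); first exact: drop sp2.
move: e1D e2D; rewrite !DE => /andP[e1T de1] /andP[e2T de2].
have [x1 e1x x1v] := incident_ends de1; have [x2 e2x x2v] := incident_ends de2.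
have [A1 [sA1 vA1 xA1 un1]] := spans_essential gW (sTE i) e1T (spJ i iJ) ess1 e1x.
have [A2 [sA2 vA2 xA2 un2]] := spans_essential gW (sTE i) e2T (spJ i iJ) ess2 e2x.
have [yA1|yA1] := boolP (y \in A1); last exact: (step e1 x1 A1).
have [yA2|yA2] := boolP (y \in A2); last exact: (step e2 x2 A2).
(* The far sides of two bridges at [v] are disjoint, so [y] misses one of them: an edge crossing the
   intersection would be one of the bridges and would then cross the far side of the other. *)
have /spansP/(_ (A1 :&: A2))[|||h hT dh] := spJ i iJ.
- by apply: subset_trans sA1; apply: subsetIl.
- by apply/set0Pn; exists y; rewrite inE yA1.
- by apply: contraTneq vW => <-; rewrite inE (negPf vA1).
have cross12 : (delta g h A1 != 0) || (delta g h A2 != 0).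
  by move: dh; rewrite /delta !inE; do 4?case: (_ \in _).
have {cross12}[h1|h2] : h = e1 \/ h = e2 by case/orP: cross12 => [/un1|/un2] ->; auto.
- have x1A2 : x1 \in A2.
    move: dh; rewrite h1 -normr_eq0 (delta_ends _ e1x) !inE (negPf vA1) xA1 /=.
    by case: (x1 \in A2).
  case/eqP: e12; apply: un2 => //; rewrite -normr_eq0 (delta_ends _ e1x) (negPf vA2) x1A2.
  by [].
have x2A1 : x2 \in A1.
  move: dh; rewrite h2 -normr_eq0 (delta_ends _ e2x) !inE (negPf vA1) xA2 /=.
  by case: (x2 \in A1).
case/eqP: e12; apply/esym/un1 => //; rewrite -normr_eq0 (delta_ends _ e2x) (negPf vA1) x2A1.
by [].
Qed.

End Packings.

Lemma valid_rootless g E W c : ends_in g E W ->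
    (forall v, v \in W -> (2 %| cut g E [set v] - c v)%Z) -> (K %| weight c W)%Z ->
    (forall A, A \subset W -> A != set0 -> A != W -> K - 2 + dist (weight c A) <= cut g E A) ->
  valid g E W c c (fun=> 0) set0.
Proof.
move=> gW parc cW cuts; have w0 A : weight (fun=> 0 : int) A = 0 by rewrite /weight big1.
split=> // [v _|v vW|||A sAW A0 AW _].
- by rewrite subrr.
- by rewrite addr0 parc.
- by left.
- by rewrite w0; have := dist_mul_ge0 k_gt0 (weight c W); have := k_gt1; clear; lia.
- by rewrite w0 addr0; apply: cuts.
Qed.

(** After vertices of small degree are excluded, a smallest violating set [A] is contracted. Its
    proper subsets satisfy the cut condition, and its own violation supplies the root bound for
    [solvable_valid] inside [A]. *)
Theorem solvable_packing (I : finType) g E W c (T : I -> {set ET}) :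
    #|I| = (2 * k - 2)%N -> ends_in g E W ->
    (forall v, v \in W -> (2 %| cut g E [set v] - c v)%Z) ->
    (K %| weight c W)%Z -> disjoint_in T E -> (forall i, spans g (T i) W) ->
  solvable g E W c.
Proof.
move=> cardI; have [n] := ubnP #|W|; elim: n g E W c T => // n IHn g E W c T ltn gW parc cW dT sp.
have IH : packing_below I #|W|.
  by move=> g' E' W' c' T' gW' parc' cW' dT' sp' lt'; apply: (IHn g' E' W' c' T') => //;
     apply: leq_trans lt' _.
have [W1|W1] := leqP #|W| 1; first exact: solvable_small gW cW W1.
have [/exists_inP[v vW cutv]|big] := boolP [exists v in W, cut g E [set v] <= (3 * k)%:Z - 3].
  (* Twice the number of subgraphs is [4k - 4], and the degree bound [3k - 3] leaves [r] at least
     [k - 1]. *)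
  apply: (@solvable_split_vertex I g E W c T setT v (4 * k%:Z - 4 - cut g E [set v])) => //.
  - by move=> i; rewrite inE.
  - by rewrite cardsT cardI; have := k_gt1; clear; lia.
  - by move: cutv; clear; lia.
pose bad A := [&& A \subset W, A != set0, A != W & cut g E A < K - 2 + dist (weight c A)].
have [/existsP[A0 badA0]|good] := boolP [exists A, bad A]; last first.
  apply: (solvable_valid (valid_rootless gW parc cW _)) => A sAW A0 AW.
  by rewrite leNgt; apply: contra good => badA; apply/existsP; exists A; rewrite /bad sAW A0 AW.
have [A /and4P[sAW An0 AW cutA] minA] := arg_minnP (fun A : {set V} => #|A|) badA0.
have A1 : (1 < #|A|)%N.
  have [//|[v defA]] := card_gt1_or_set1 An0; case/negP: big; apply/exists_inP; exists v.
    by rewrite -sub1set -defA.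
  rewrite -defA; have := dist_mul_le k_gt0 (weight c A).
  have := parc v; rewrite -sub1set -defA sAW => /(_ isT).
  have := dist_mul_parity k_gt0 (weight c A).
  have -> : c v = weight c A by rewrite defA weight1.
  by move: cutA; clear; lia.
have /card_gt0P[a aA] : (0 < #|A|)%N by exact: ltnW.
have [|o [so outA onA]] := solvable_contract (c := c) gW sAW aA.
  apply: (IH _ _ _ _ T).
  - exact: ends_in_contract.
  - move=> u _; rewrite (cut_contract _ _ gW) /push; apply: parity_cut_weight => w wF.
    by apply: parc; apply: (subsetP (fiber_sub (collapse A a) W [set u])).
  - rewrite weight_push; have -> // : fiber (collapse A a) W (collapse A a @: W) = W.
    by apply/eqP; rewrite fiber_eq_full.
  - exact: dT.
  - by move=> i; apply: spans_contract gW _ (sp i); apply: dT.1.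
  - exact: card_collapse.
have w0 B : weight (fun=> 0 : int) B = 0 by rewrite /weight big1.
apply: (solvable_inner (b := c) (s := fun=> 0) (X := set0) (o := o) gW sAW) => //.
- by move=> v _; rewrite subrr.
- by move=> v /(subsetP sAW); apply: parc.
- by move=> v /(subsetP sAW) vW; rewrite addr0 parc.
- by left.
- by rewrite w0 addr0 ltW.
- move=> B sBA B0 BA _; rewrite w0 addr0 leNgt; apply: contra BA => badB.
  rewrite eqEcard sBA minA // /bad B0 badB (subset_trans sBA sAW) andbT /=.
  by apply: contraNneq AW => BW; rewrite eqEsubset sAW -{1}BW sBA.
- by move=> c' s' val'; apply: solvable_valid val'.
Qed.

End Orientations.

(** * Equitable colourings of bipartite graphs *)

(** For a fixed sum, the sum of squares depends only on the difference, written [m - n + (n - m)]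
    with truncated subtraction. *)
Lemma leqif_sum_sqr (a b a' b' : nat) :
    (a' + b' = a + b)%N -> (a' <= b'.+1)%N -> (b' <= a'.+1)%N ->
  (a' ^ 2 + b' ^ 2 <= a ^ 2 + b ^ 2 ?= iff (a <= b.+1) && (b <= a.+1))%N.
Proof.
move=> e le1 le2.
have sqr (m n : nat) : ((m + n) ^ 2 + (m - n + (n - m)) ^ 2 = (m ^ 2 + n ^ 2).*2)%N.
  by have [le|/ltnW le] := leqP m n; rewrite -!mulnn; nia.
rewrite /leqif -leq_double -(inj_eq double_inj) -!sqr e leq_add2l eqn_add2l.
rewrite leq_exp2r // eqn_exp2r //.
by split; lia.
Qed.

Section EquitableColouring.
Variables (V ET : finType) (l r : ET -> V) (k : nat).
Hypothesis k_gt0 : (0 < k)%N.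
Implicit Types (f : ET -> 'I_k) (x y : V + V) (i j h : 'I_k).

(* The edges, directed from [l e] to [r e], are those of a bipartite graph between
   two copies of [V]. *)
Let mult x e : nat := ((inl (l e) == x) + (inr (r e) == x))%N.
Let ncol f x i : nat := (\sum_(e | f e == i) mult x e)%N.
Let energy f : nat := (\sum_x \sum_i ncol f x i ^ 2)%N.

(** The edges coloured [i] or [j] get a balanced orientation, and their direction becomes the new
    colour. In a bipartite graph the net out-degree is, up to sign, the difference of the two colour
    counts. *)
Let recolour f i j : i != j -> exists f' : {ffun ET -> 'I_k}, forall x,
  [/\ forall h, h != i -> h != j -> ncol f' x h = ncol f x h,
      (ncol f' x i + ncol f' x j = ncol f x i + ncol f x j)%N,
      (ncol f' x i <= (ncol f' x j).+1)%N & (ncol f' x j <= (ncol f' x i).+1)%N].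
Proof.
move=> ij; pose S := [set e | (f e == i) || (f e == j)].
pose g e : (V + V) * (V + V) := (inl (l e), inr (r e)).
have [o so bal] := balanced_signing g S.
pose f' := [ffun e => if e \in S then if o e == 1 then i else j else f e].
have f'i e : (f' e == i) = (e \in S) && (o e == 1).
  rewrite ffunE; have [eS|] := boolP (e \in S).
    by case: (o e == 1); rewrite ?eqxx // eq_sym (negPf ij).
  by rewrite inE negb_or => /andP[/negPf->].
have f'j e : (f' e == j) = (e \in S) && (o e != 1).
  rewrite ffunE; have [eS|] := boolP (e \in S).
    by case: (o e == 1); rewrite ?eqxx // (negPf ij).
  by rewrite inE negb_or => /andP[_ /negPf->].
have countS (f0 : ET -> 'I_k) x : (forall e, (f0 e == i) || (f0 e == j) = (e \in S)) ->
    (ncol f0 x i + ncol f0 x j = \sum_(e in S) mult x e)%N.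
  move=> f0S; rewrite /ncol big_mkcond [X in (_ + X)%N]big_mkcond -big_split [RHS]big_mkcond /=.
  apply: eq_bigr => e _; rewrite -f0S; have [->|_] := eqVneq (f0 e) i; rewrite ?add0n //.
  by rewrite (negPf ij) addn0.
have diffE x : (ncol f' x i)%:Z - (ncol f' x j)%:Z = \sum_(e in S) o e * (mult x e)%:Z.
  rewrite /ncol -[X in X - _]natz -[X in _ - X]natz !natr_sum big_mkcond.
  rewrite [X in _ - X]big_mkcond -sumrB [RHS]big_mkcond; apply: eq_bigr => e _.
  rewrite f'i f'j natz; case: (e \in S) => //=.
  by case: (so e) => -> /=; rewrite ?mul1r ?mulN1r ?subr0 ?sub0r.
have balx x : `|(ncol f' x i)%:Z - (ncol f' x j)%:Z| <= 1.
  have := bal x; rewrite diffE /net /mult; case: x => v.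
    by congr (`|_| <= _); apply: eq_bigr => e _; congr (_ * _); rewrite /delta !inE /= subr0 addn0.
  rewrite -normrN -sumrN; congr (`|_| <= _); apply: eq_bigr => e _.
  by rewrite -mulrN; congr (_ * _); rewrite /delta !inE /= sub0r opprK.
exists f' => x; split=> [h hi hj|||].
- apply: eq_bigl => e; rewrite ffunE inE; have [->|ni] := eqVneq (f e) i.
    by case: (o e == 1); rewrite /= ![_ == h]eq_sym (negPf hi) ?(negPf hj).
  have [->|//] := eqVneq (f e) j.
  by case: (o e == 1); rewrite /= ![_ == h]eq_sym (negPf hj) ?(negPf hi).
- rewrite !countS // => e; first by rewrite inE.
  by rewrite f'i f'j; case: (e \in S); case: (o e == 1).
- by have := balx x; clear; lia.
- by have := balx x; clear; lia.
Qed.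

(** A colouring minimizing the sum of squared counts is equitable: balancing two colours that are
    unfair at one vertex lowers the energy there and raises it nowhere. *)
Theorem equitable_colouring : exists f, forall v i j,
  (#|[set e | (l e == v) && (f e == i)]| <= #|[set e | (l e == v) && (f e == j)]|.+1)%N /\
  (#|[set e | (r e == v) && (f e == i)]| <= #|[set e | (r e == v) && (f e == j)]|.+1)%N.
Proof.
have [f _ minf] := arg_minnP (fun f : {ffun ET -> 'I_k} => energy f)
  (isT : predT [ffun=> Ordinal k_gt0]).
have fair x i j : (ncol f x i <= (ncol f x j).+1)%N.
  rewrite leqNgt; apply/negP => lt_ji.
  have ij : i != j by apply: contraTneq lt_ji => ->; rewrite -leqNgt leqW.
  have [f' f'P] := recolour f ij.
  have colE (f0 : ET -> 'I_k) y : (\sum_h ncol f0 y h ^ 2 =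
      ncol f0 y i ^ 2 + ncol f0 y j ^ 2 +
      \sum_(h | (h != i) && (h != j)) ncol f0 y h ^ 2)%N.
    by rewrite (bigD1 i) //= (bigD1 j) ?[j == i]eq_sym //= addnA.
  have rest y : (\sum_(h | (h != i) && (h != j)) ncol f' y h ^ 2 =
      \sum_(h | (h != i) && (h != j)) ncol f y h ^ 2)%N.
    by apply: eq_bigr => h /andP[hi hj]; have [same _ _ _] := f'P y; rewrite same.
  have : (energy f' < energy f)%N.
    rewrite /energy (bigD1 x) //= [X in (_ < X)%N](bigD1 x) //= -addSn leq_add //.
      by rewrite !colE rest -addSn leq_add2r; have [_ e1 le1 le2] := f'P x;
         rewrite (ltn_leqif (leqif_sum_sqr e1 le1 le2)) leqNgt lt_ji.
    apply: leq_sum => y _; rewrite !colE rest leq_add2r.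
    by have [_ e1 le1 le2] := f'P y; apply: (leqif_sum_sqr e1 le1 le2).1.
  by rewrite ltnNge minf.
have countl v i : ncol f (inl v) i = #|[set e | (l e == v) && (f e == i)]|.
  rewrite /ncol -sum1_card big_mkcond [RHS]big_mkcond; apply: eq_bigr => e _.
  rewrite inE /mult andbC; case: (f e == i) => //=.
  by rewrite addn0 (inj_eq (@inl_inj _ _)); case: eqP.
have countr v i : ncol f (inr v) i = #|[set e | (r e == v) && (f e == i)]|.
  rewrite /ncol -sum1_card big_mkcond [RHS]big_mkcond; apply: eq_bigr => e _.
  by rewrite inE /mult andbC; case: (f e == i).
by exists f => v i j; rewrite -!countl -!countr.
Qed.

End EquitableColouring.

(** * Factors *)

Section Multigraph.
Variable G : mgraph.
Notation V := (vertex G).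
Notation ET := (edge G).
Implicit Types (F : {set ET}) (A : {set V}) (v : V) (e : ET).

Lemma sum_deg : (\sum_v deg [set: ET] v)%N = (2 * #|ET|)%N.
Proof.
rewrite /deg exchange_big /= (eq_bigr (fun=> 2%N)) => [|e _].
  by rewrite sum_nat_const cardsT mulnC.
have one (u : V) : (\sum_v (u == v))%N = 1%N.
  rewrite (bigD1 u) //= eqxx big1 ?addn0 // => v vu.
  by rewrite eq_sym (negPf vu).
by rewrite big_split /= !one.
Qed.

Lemma ends_in_setT F : ends_in (@ends G) F [set: V].
Proof. by move=> e _; rewrite !inE. Qed.

Lemma parity_deg v : (2 %| cut (@ends G) [set: ET] [set v] - (deg [set: ET] v)%:Z)%Z.
Proof.
rewrite /cut /deg -[X in _ - X]natz natr_sum -sumrB; apply: dvdz_sum => e _.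
by rewrite /delta !inE; case: (_ == v); case: (_ == v).
Qed.

Lemma connected_crossing F A : connected F -> A != set0 -> A != setT ->
  exists2 e, e \in F & delta (@ends G) e A != 0.
Proof.
move=> /forallP con /set0Pn[x xA] AT.
have [y yA] : exists y, y \notin A.
  apply/existsP; rewrite -negb_forall; apply: contra AT => /forallP all_A.
  by apply/eqP/setP => v; rewrite inE all_A.
apply/exists_inP; apply: contraT => /exists_inPn none; case/negP: yA.
have clA : closed (adj F) A.
  move=> u v /exists_inP[e eF euv]; have := none e eF; rewrite negbK -normr_eq0.
  have /delta_ends -> : has_ends (@ends G) e u v by case/orP: euv => /eqP; [left | right].
  by case: (u \in A); case: (v \in A).
by rewrite -(closed_connect clA (forallP (con x) y)).
Qed.

(** * Orientations from the connectivity hypotheses *)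

Section Orientation.
Variables (k : nat) (z : V).
Hypothesis k_gt1 : (1 < k)%N.

(* With this target every vertex other than [z] gets out-degree 0 modulo [k]. *)
Definition net_target v : int :=
  if v == z then (2 * #|ET|)%:Z - (deg [set: ET] z)%:Z else - (deg [set: ET] v)%:Z.

Lemma parity_net_target v : (2 %| cut (@ends G) [set: ET] [set v] - net_target v)%Z.
Proof.
by have := parity_deg v; rewrite /net_target; case: eqP => [->|_]; clear; lia.
Qed.

(** By the handshake identity, the term [2 * #|ET|] at [z] balances all degrees. *)
Lemma weight_net_target : weight net_target [set: V] = 0.
Proof.
rewrite /weight (bigD1 z) ?inE //= /net_target eqxx.
rewrite (eq_bigr (fun v => - (deg [set: ET] v)%:Z)) => [|v /andP[_ /negPf-> //]].
rewrite sumrN -sum_deg (bigD1 z) //=.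
have -> : \sum_(v in [set: V] | v != z) (deg [set: ET] v)%:Z =
    (\sum_(v | v != z) deg [set: ET] v)%N%:Z.
  rewrite -[RHS]natz natr_sum; apply: eq_big => [v|v _]; first by rewrite inE.
  by rewrite natz.
by rewrite PoszD; lia.
Qed.

(** The cut condition asks for at most [3k - 2] edges, one more than the hypothesis gives; parity
    supplies it in the extreme case. *)
Lemma orientation_edge_connected : edge_connected G (3 * k - 3) ->
  solvable k (@ends G) [set: ET] [set: V] net_target.
Proof.
move=> conn; apply: (solvable_valid k_gt1 (b := net_target) (s := fun=> 0) (X := set0)).
apply: (valid_rootless k_gt1) => [|v _||A _ A0 AT].
- exact: ends_in_setT.
- exact: parity_net_target.
- by rewrite weight_net_target.
have cutA : (3 * k - 3)%:Z <= cut (@ends G) [set: ET] A.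
  rewrite cut_card leNgt; apply/negP => small.
  have [|e] := connected_crossing (conn [set e in [set: ET] | delta (@ends G) e A != 0] _) A0 AT.
    by move: small; clear; lia.
  by rewrite !inE /= negbK => /eqP->.
have := parity_cut_weight (A := A) (fun v _ => parity_net_target v).
have := dist_mul_parity (ltnW k_gt1) (weight net_target A).
have := dist_mul_le (ltnW k_gt1) (weight net_target A).
by move: cutA k_gt1; clear; lia.
Qed.

Lemma orientation_tree_connected : tree_connected G (2 * k - 2) ->
  solvable k (@ends G) [set: ET] [set: V] net_target.
Proof.
move=> [T [treeT disjT]]; apply: (solvable_packing k_gt1 (T := T)).
- by rewrite card_ord.
- exact: ends_in_setT.
- by move=> v _; apply: parity_net_target.
- by rewrite weight_net_target.
- by split=> // i; apply: subsetT.
move=> i; apply/spansP => A _ A0 AT; have [conT _] := treeT i.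
exact: connected_crossing conT A0 AT.
Qed.

End Orientation.

End Multigraph.

(** Summing the comparisons of [a i] with all terms gives an error below [k], since the comparison
    of [a i] with itself is exact. *)
Lemma near_average (k : nat) (a : 'I_k -> nat) : (forall i j, (a i <= (a j).+1)%N) ->
  forall i, (k * a i < \sum_j a j + k)%N /\ (\sum_j a j < k * a i + k)%N.
Proof.
move=> fair i; have sumk (m : nat) : (\sum_(j < k) m = k * m)%N by rewrite sum_nat_const card_ord.
have lt_sum (F H : 'I_k -> nat) : (forall j, F j <= (H j).+1)%N -> (F i <= H i)%N ->
    (\sum_j F j < \sum_j H j + k)%N.
  move=> leFH leFHi; rewrite -[X in (_ + X)%N]muln1 -sumk -big_split /=.
  rewrite (bigD1 i) //= [X in (_ < X)%N](bigD1 i) //= -addSn leq_add //.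
    by rewrite addn1 ltnS.
  by apply: leq_sum => j _; rewrite addn1.
by split; rewrite -sumk; apply: lt_sum.
Qed.

Lemma ratr_near (x y k m : nat) : (0 < k)%N -> (k * x < y + m * k)%N -> (y < k * x + m * k)%N ->
  `|x%:R - y%:R / k%:R| < m%:R :> rat.
Proof.
move=> k_gt0 lt1 lt2; have kR : 0 < k%:R :> rat by rewrite ltr0n.
have -> : x%:R - y%:R / k%:R = ((k * x)%:R - y%:R) / k%:R :> rat.
  by rewrite natrM mulrBl mulrAC divff ?mul1r // gt_eqF.
rewrite normrM normfV (gtr0_norm kR) ltr_pdivrMr // -natrM ltr_norml.
apply/andP; split; last by rewrite ltrBlDr -natrD ltr_nat addnC.
by rewrite -subr_gt0 opprK addrAC subr_gt0 -natrD ltr_nat.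
Qed.

Theorem theorem3p2 (G : mgraph) (z : vertex G) (k : nat) (hk : (0 < k)%N)
    (hG : edge_connected G (3 * k - 3)%N \/ tree_connected G (2 * k - 2)%N) :
  exists F : 'I_k -> {set edge G},
    [/\ edge_decomposition F,
        forall i : 'I_k,
          `|#|F i|%:R - #|edge G|%:R / k%:R| < 1 :> rat,
        forall (i : 'I_k) (v : vertex G),
          `|(deg (F i) v)%:R - (deg [set: edge G] v)%:R / k%:R|
            < (if v == z then 2 else 1) :> rat
      & forall i j : 'I_k,
          `|(deg (F i) z)%:R - (deg (F j) z)%:R| <= 2 :> rat].
Proof.
have [o o_out] : exists o : edge G -> bool, forall v, v != z ->
    (k %| #|[set e | (if o e then (ends e).1 else (ends e).2) == v]|)%N.
  have [k1|k_gt1] := leqP k 1.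
    by exists xpredT => v _; rewrite (_ : k = 1%N) ?dvd1n //; lia.
  have [o so oc] : solvable k (@ends G) [set: edge G] [set: vertex G] (net_target z).
    by case: hG; [apply: orientation_edge_connected | apply: orientation_tree_connected].
  exists (fun e => o e == 1) => v vz; have := oc v (in_setT v).
  set d := #|_|; rewrite /net_target (negPf vz) opprK.
  (* Net out-degree plus degree counts every outgoing edge twice, loops included; the factor 2
     cancels against the modulus [2k]. *)
  suff -> : net (@ends G) o [set: edge G] [set v] + (deg [set: edge G] v)%:Z = 2 * d%:Z.
    by rewrite PoszM dvdz_mul2l.
  rewrite /d -sum1_card /net /deg -[X in _ + X]natz -[X in 2 * X]natz !natr_sum mulr_sumr.
  rewrite -big_split [RHS]big_mkcond [LHS]big_mkcond /=; apply: eq_bigr => e _.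
  rewrite !inE /delta !inE natz.
  by case: (so e) => -> /=; case: (_ == v); case: (_ == v).
pose t e := if o e then (ends e).1 else (ends e).2.
pose h e := if o e then (ends e).2 else (ends e).1.
have [f fair] := equitable_colouring t h hk.
pose out v i := #|[set e | (t e == v) && (f e == i)]|.
pose inn v i := #|[set e | (h e == v) && (f e == i)]|.
have degF i v : deg [set e | f e == i] v = (out v i + inn v i)%N.
  rewrite /deg /out /inn -!sum1_card [LHS]big_mkcond [X in (X + _)%N]big_mkcond
    [X in (_ + X)%N]big_mkcond -big_split; apply: eq_bigr => e _ /=.
  rewrite !inE /t /h; case: (f e == i); rewrite ?andbF // !andbT.
  by case: (o e); case: (_ == v); case: (_ == v).
have sum_col (P : pred (edge G)) : (\sum_i #|[set e | P e && (f e == i)]| = #|[set e | P e]|)%N.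
  rewrite -sum1_card (partition_big f predT) //=; apply: eq_bigr => i _.
  by rewrite -sum1_card; apply: eq_bigl => e; rewrite !inE.
have deg_all v : deg [set: edge G] v = (\sum_i out v i + \sum_i inn v i)%N.
  rewrite !sum_col /deg -!sum1_card [LHS]big_mkcond [X in (X + _)%N]big_mkcond
    [X in (_ + X)%N]big_mkcond -big_split; apply: eq_bigr => e _ /=.
  by rewrite !inE /t /h; case: (o e); case: (_ == v); case: (_ == v).
have out_near v i : (k * out v i < \sum_j out v j + k)%N /\ (\sum_j out v j < k * out v i + k)%N.
  exact: near_average (fun i j => (fair v i j).1) i.
have inn_near v i : (k * inn v i < \sum_j inn v j + k)%N /\ (\sum_j inn v j < k * inn v i + k)%N.
  exact: near_average (fun i j => (fair v i j).2) i.
(* A total divisible by [k] that is shared with error below one is shared exactly. *)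
have out_eq v i : v != z -> (k * out v i = \sum_j out v j)%N.
  move=> vz; have [lt1 lt2] := out_near v i.
  have /dvdnP[q qE] : (k %| \sum_j out v j)%N by rewrite sum_col; apply: o_out.
  rewrite qE in lt1 lt2 *; rewrite [(q * k)%N]mulnC -!mulnSr !ltn_pmul2l // !ltnS in lt1 lt2 *.
  by congr muln; apply/eqP; rewrite eqn_leq lt1.
exists (fun i => [set e | f e == i]); split.
- split; first by apply/setP => e; rewrite inE; apply/bigcupP; exists (f e); rewrite ?inE.
  move=> i j ij; apply/pred0P => e /=; rewrite !inE; apply/negbTE.
  by apply: contra ij => /andP[/eqP-> /eqP->].
(* Edges are counted by their tails, so the only rounding error is that of the out-degree at [z]. *)
- move=> i; have card_out (P : pred (edge G)) :
      #|[set e | P e]| = (\sum_v #|[set e | (t e == v) && P e]|)%N.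
    rewrite -sum1_card (partition_big t predT) //=; apply: eq_bigr => v _.
    by rewrite -sum1_card; apply: eq_bigl => e; rewrite !inE andbC.
  have colE : #|[set e | f e == i]| = (out z i + \sum_(v | v != z) out v i)%N.
    by rewrite card_out (bigD1 z).
  have allE : #|edge G| = (\sum_j out z j + \sum_(v | v != z) \sum_j out v j)%N.
    rewrite -cardsT -(sum_col predT) exchange_big -big_split; apply: eq_bigr => j _ /=.
    by rewrite card_out (bigD1 z).
  have [lt1 lt2] := out_near z i.
  have rest : (k * \sum_(v | v != z) out v i = \sum_(v | v != z) \sum_j out v j)%N.
    by rewrite big_distrr; apply: eq_bigr => v /out_eq.
  apply: (@ratr_near _ _ k 1) => //; rewrite colE allE mulnDr rest mul1n.
    by rewrite addnAC ltn_add2r.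
  by rewrite addnAC ltn_add2r.
- move=> i v; rewrite degF deg_all; have := out_near v i; have := inn_near v i.
  move=> -[in1 in2] [out1 out2].
  (* At [z] the errors of out-degree and in-degree add up; elsewhere the out-degree is exact. *)
  have [_|vz] := eqVneq v z; [apply: (@ratr_near _ _ k 2) | apply: (@ratr_near _ _ k 1)];
    rewrite // mulnDr.
  + by move: in1 out1; clear; lia.
  + by move: in2 out2; clear; lia.
  + by rewrite out_eq // mul1n -addnA ltn_add2l.
  by rewrite out_eq // mul1n -addnA ltn_add2l.
move=> i j; rewrite !degF ler_norml.
have [oij iij] := fair z i j; have [oji iji] := fair z j i.
apply/andP; split; last first.
  by rewrite lerBlDr -natrD ler_nat; move: oij iij; rewrite /out /inn; clear; lia.
rewrite -subr_ge0 opprK addrAC subr_ge0 -natrD ler_nat.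
by move: oji iji; rewrite /out /inn; clear; lia.
Qed.
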